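(* Let $d\ge1$, $p\in[1,+\infty)$ and let $|\cdot|$ be any norm on $\mathbb{R}^d$. Let $\mu_n\in\mathcal{P}_p(\mathbb{R}^d)$ for $n\in\mathbb{N}^*\cup\{\infty\}$. The following properties are equivalent: (i) $\mathcal{W}_p(\mu_n,\mu_\infty)\to0$ as $n\to+\infty$; (ii) for every $N\ge1$, $e_{N,p}(\mu_n,\cdot)\to e_{N,p}(\mu_\infty,\cdot)$ uniformly on $(\mathbb{R}^d)^N$ as $n\to+\infty$; (iii) there exists an integer $N$ with $N\ge c(d,|\cdot|)+1$, or with $N\ge d+2$ if $|\cdot|$ is Euclidean, such that $e_{N,p}(\mu_n,\cdot)\to e_{N,p}(\mu_\infty,\cdot)$ pointwise on $(\mathbb{R}^d)^N$ as $n\to+\infty$.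
   Context: $\mathcal{P}_p(\mathbb{R}^d)$ is the set of Borel probability measures $\mu$ on $\mathbb{R}^d$ with $\int|\xi|^p\mu(d\xi)<+\infty$. $\mathcal{W}_p$ is the $L^p$-Wasserstein distance with respect to $|\cdot|$: $\mathcal{W}_p(\mu,\nu)=\big(\inf_{\pi}\int|x-y|^p\pi(dx,dy)\big)^{1/p}$, the infimum being over all couplings $\pi$ of $\mu$ and $\nu$. For $\mu\in\mathcal{P}_p(\mathbb{R}^d)$ and $N\ge1$, $e_{N,p}(\mu,\cdot):(\mathbb{R}^d)^N\to\mathbb{R}_+$ is $e_{N,p}(\mu,(x_1,\dots,x_N))=\big[\int_{\mathbb{R}^d}\min_{1\le i\le N}|\xi-x_i|^p\,\mu(d\xi)\big]^{1/p}$. Let $S_{|\cdot|}(0,1)$ be the unit sphere and $\bar B_{|\cdot|}(a,1)$ the closed unit ball centered at $a$ for the norm $|\cdot|$. The minimal sphere covering number is $c(d,|\cdot|)=\min\{k:\exists\,\{a_1,\dots,a_k\}\subset S_{|\cdot|}(0,1)\text{ with }S_{|\cdot|}(0,1)\subset\bigcup_{i=1}^k\bar B_{|\cdot|}(a_i,1)\}$, which is finite. ''Euclidean'' means that the norm is induced by an inner product. *)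

(* Defs.v *)
From HB Require Import structures.
From mathcomp Require Import all_boot all_order all_algebra.
From mathcomp Require Import sesquilinear.
From mathcomp Require Import all_classical all_reals all_analysis.

Set Implicit Arguments.
Unset Strict Implicit.
Unset Printing Implicit Defensive.

Import Order.TTheory GRing.Theory Num.Theory.
Import numFieldNormedType.Exports.

Local Open Scope classical_set_scope.
Local Open Scope ring_scope.

(* The library's own norm on ['rV[R]_d] is the sup norm; it is used below only
   for its topology, which is that of every norm on R^d. *)
Record is_norm (R : realType) (d : nat) (nrm : 'rV[R]_d -> R) : Prop := IsNorm {
  is_norm_triangle : forall x y, nrm (x + y) <= nrm x + nrm y ;
  is_normZ : forall (a : R) x, nrm (a *: x) = `|a| * nrm x ;
  is_norm0_eq0 : forall x, nrm x = 0 -> x = 0 }.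

Definition euclidean_norm (R : realType) (d : nat) (nrm : 'rV[R]_d -> R) : Prop :=
  exists ip : {dot 'rV[R]_d for (@idfun R)}, forall x, nrm x ^+ 2 = ip x x.

Definition unit_sphere (R : realType) (d : nat) (nrm : 'rV[R]_d -> R)
    : set 'rV[R]_d := [set x | nrm x = 1].

Definition closed_unit_ball (R : realType) (d : nat) (nrm : 'rV[R]_d -> R)
    (a : 'rV[R]_d) : set 'rV[R]_d := [set x | nrm (x - a) <= 1].

Definition sphere_covering (R : realType) (d : nat) (nrm : 'rV[R]_d -> R)
    (k : nat) : Prop :=
  exists a : 'I_k -> 'rV[R]_d,
    (forall i, unit_sphere nrm (a i)) /\
    unit_sphere nrm `<=` \bigcup_(i in setT) closed_unit_ball nrm (a i).

(* The minimum of [sphere_covering nrm]. By compactness of the sphere that set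
   is nonempty when [nrm] is a norm, so the default value of [get] is never
   used. *)
Definition sphere_covering_number (R : realType) (d : nat)
    (nrm : 'rV[R]_d -> R) : nat :=
  get [set k | sphere_covering nrm k /\
               forall j, sphere_covering nrm j -> (k <= j)%N].

Definition borelRd (R : realType) (d : nat) :=
  g_sigma_algebraType (@open 'rV[R]_d).

Definition finite_moment (R : realType) (d : nat) (nrm : 'rV[R]_d -> R) (p : R)
    (mu : probability (borelRd R d) R) : Prop :=
  (\int[mu]_(xi in setT) ((nrm xi) `^ p)%:E < +oo)%E.

Definition coupling (R : realType) (d : nat) (mu nu : probability (borelRd R d) R)
    (pi : probability (borelRd R d * borelRd R d)%type R) : Prop :=
  forall A : set (borelRd R d), measurable A ->
    pushforward pi fst A = mu A /\ pushforward pi snd A = nu A.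

Definition wasserstein (R : realType) (d : nat) (nrm : 'rV[R]_d -> R) (p : R)
    (mu nu : probability (borelRd R d) R) : \bar R :=
  (ereal_inf [set (\int[pi]_(z in setT)
                     ((nrm ((z.1 : 'rV[R]_d) - (z.2 : 'rV[R]_d))) `^ p)%:E)%E
             | pi in coupling mu nu] `^ p^-1)%E.

(* The minimum over ['I_N] is taken in [\bar R], where its neutral element
   [+oo] exists; it is real for [0 < N], and then [fine] loses nothing as soon
   as [mu] has a finite [p]-th moment. *)
Definition quant_error (R : realType) (d : nat) (nrm : 'rV[R]_d -> R) (p : R)
    (N : nat) (mu : probability (borelRd R d) R) (x : {ffun 'I_N -> 'rV[R]_d})
    : R :=
  fine ((\int[mu]_(xi in setT)
           \big[mine/+oo]_(i < N)
             ((nrm ((xi : 'rV[R]_d) - x i)) `^ p)%:E) `^ p^-1)%E.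

(* Main.v *)
(* Choose vectors b_i such that every point far from the origin is at least as
   close to some b_i as to the origin. Then the integrands of the quantizers
   (a + r b_i)_i and (a, (a + r b_i)_i) differ by a compactly supported bump
   around a, so pointwise convergence of the quantization errors gives
   convergence of the integrals of all translates and dilates of one bump phi.
   Sums of such bumps over the lattice delta r Z^d overlap at most L^d times,
   with L independent of r; hence every continuous compactly supported f is
   approximated in this span up to a fixed fraction of its sup norm, and
   iterating gives density, without any convolution. Together with convergence
   of the p-th moments this yields Wasserstein convergence: given a fine
   partition of unity psi_i, the coupling matches the masses of psi_i d(mu_n)
   and psi_i d(mu) piece by piece and couples the remainders independently; it
   is written as a density with respect to the product measure. The converse
   direction is Minkowski's inequality in L^p of a coupling. *)
Require Import Defs.
From HB Require Import structures.
From mathcomp Require Import all_boot all_order all_algebra.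
From mathcomp Require Import sesquilinear finmap zify.
From mathcomp Require Import all_classical all_reals all_analysis.
From mathcomp Require Import measurable_realfun ring lra.
Import Order.TTheory GRing.Theory Num.Theory.
Import numFieldNormedType.Exports.
Local Open Scope classical_set_scope.
Local Open Scope ring_scope.

Set Implicit Arguments.
Unset Strict Implicit.
Unset Printing Implicit Defensive.

(** * Norms on R^d *)

(** The thresholds on [N] count one quantizer point for each vector b_i plus one for the centre [a];
    in the Euclidean case d + 1 vectors suffice, because a basis together with minus its sum
    positively spans R^d. Nothing is known about the bump beyond continuity, nonnegativity, bounded
    support and a positive value at the origin: its lattice translates need not add up to a
    constant. On the support of f their sum is only pinched between two positive bounds, whose ratio
    does not depend on the dilation. Hence one approximation step does not reach f: its coefficients
    are small enough never to overshoot, and it gains a fixed factor in sup norm. Test functions of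
    bounded support do not see mass escaping to infinity; the quantizer with all its points at the
    origin does, since the p-th power of its error is the p-th moment. The partition of unity is
    kept strictly below 1 so that the independent remainder never has zero mass, even when the two
    measures coincide. *)

Section powR_extra.
Context {R : realType}.
Implicit Types (p s t : R).

Lemma le_powR p s t : 0 <= p -> 0 <= s -> s <= t -> s `^ p <= t `^ p.
Proof.
by move=> p0 s0 st; apply: ge0_ler_powR => //; rewrite nnegrE// (le_trans s0).
Qed.

Lemma powRK p t : 0 < p -> 0 <= t -> (t `^ p) `^ p^-1 = t.
Proof. by move=> p0 t0; rewrite -powRrM mulfV ?gt_eqF// powRr1. Qed.

Lemma powRVK p t : 0 < p -> 0 <= t -> (t `^ p^-1) `^ p = t.
Proof. by move=> p0 t0; rewrite -powRrM mulVf ?gt_eqF// powRr1. Qed.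

Lemma powRD_le p s t : 0 <= p -> 0 <= s -> 0 <= t ->
  (s + t) `^ p <= 2 `^ p * (s `^ p + t `^ p).
Proof.
move=> p0 s0 t0; wlog st : s t s0 t0 / s <= t.
  by move=> H; have /orP[/H|/H] := le_total s t; first exact;
     rewrite [t + s]addrC [_ `^ p + _]addrC; exact.
apply: (@le_trans _ _ ((2 * t) `^ p)).
  by apply: le_powR; rewrite ?addr_ge0// mulr_natl mulr2n lerD.
by rewrite powRM// ler_wpM2l ?powR_ge0// lerDr powR_ge0.
Qed.

(** The absolute value keeps the base nonnegative, so that continuity holds on the whole line. Away
    from 0 it comes from differentiability of [powR]; at 0 the radius is the p-th root of [e]. *)
Lemma continuous_powR_norm p : 0 < p -> continuous (fun t : R => `|t| `^ p).
Proof.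
move=> p0 t; have [t0|t0] := eqVneq t 0.
  rewrite /continuous_at t0 normr0 powR0 ?gt_eqF//.
  apply/cvgrPdist_lt => e e0; have ep0 : 0 < e `^ p^-1 by rewrite powR_gt0.
  near=> s; have se : `|s| < e `^ p^-1.
    near: s; apply/nbhs_ballP; exists (e `^ p^-1) => //= s.
    by rewrite /= sub0r normrN.
  rewrite sub0r normrN ger0_norm ?powR_ge0// -[ltRHS](@powRVK p)// ?(ltW e0)//.
  by apply: gt0_ltr_powR => //; rewrite nnegrE// ltW.
apply: (@continuous_comp _ _ _ (fun u : R => `|u|) (fun u : R => u `^ p)).
  exact: norm_continuous.
apply: differentiable_continuous; apply/derivable1_diffP.
by have [] := @is_derive1_powR R p `|t| _; rewrite ?normr_gt0.
Unshelve. all: by end_near. Qed.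

Lemma cvg_powR {T : Type} {F : set_system T} {FF : Filter F} (f : T -> R) (p l : R) :
  0 < p -> (forall x, 0 <= f x) -> 0 <= l ->
  f @ F --> l -> (fun x => f x `^ p) @ F --> l `^ p.
Proof.
move=> p0 f0 l0 fl.
have -> : (fun x => f x `^ p) = (fun t => `|t| `^ p) \o f.
  by apply/funext => x /=; rewrite ger0_norm.
have := cvg_comp _ _ fl (@continuous_powR_norm p p0 l).
by rewrite /continuous_at (ger0_norm l0).
Qed.

End powR_extra.

Section norm_theory.
Context {R : realType} {d : nat} {nrm : 'rV[R]_d -> R}.
Hypothesis hn : is_norm nrm.

Lemma nrm0 : nrm 0 = 0.
Proof. by rewrite -(scale0r (0 : 'rV[R]_d)) (is_normZ hn) normr0 mul0r. Qed.

Lemma nrmN x : nrm (- x) = nrm x.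
Proof. by rewrite -scaleN1r (is_normZ hn) normrN1 mul1r. Qed.

Lemma nrm_ge0 x : 0 <= nrm x.
Proof.
by have := is_norm_triangle hn x (- x); rewrite subrr nrm0 nrmN; lra.
Qed.

Lemma nrm_gt0 x : x != 0 -> 0 < nrm x.
Proof.
move=> x0; rewrite lt_neqAle nrm_ge0 andbT; apply: contra x0 => /eqP/esym.
by move=> /(is_norm0_eq0 hn) ->.
Qed.

Lemma nrmB x y : nrm (x - y) = nrm (y - x).
Proof. by rewrite -nrmN opprB. Qed.

Lemma nrm_triangleB x y z : nrm (x - z) <= nrm (x - y) + nrm (y - z).
Proof. by rewrite -[x - z](subrKA y) (is_norm_triangle hn). Qed.

Lemma nrm_le_dist x y : nrm x <= nrm y + nrm (x - y).
Proof. by rewrite -{1}[x](subrKC y) (is_norm_triangle hn). Qed.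

Lemma nrm_dist x y : `|nrm x - nrm y| <= nrm (x - y).
Proof.
rewrite ler_norml lerBlDl nrm_le_dist andbT lerNl opprB lerBlDl nrmB.
exact: nrm_le_dist.
Qed.

Lemma nrm_sum (I : finType) (F : I -> 'rV[R]_d) :
  nrm (\sum_i F i) <= \sum_i nrm (F i).
Proof.
elim/big_ind2: _ => [|x a y b xa yb|//]; first by rewrite nrm0.
by rewrite (le_trans (is_norm_triangle hn _ _))// lerD.
Qed.

Lemma coord_le_norm (x : 'rV[R]_d) i : `|x ord0 i| <= `|x|.
Proof.
rewrite [leRHS]/Num.norm /= mx_normrE.
by apply/bigmax_geP; right => /=; exists (ord0, i).
Qed.

Lemma norm_le_coord (x : 'rV[R]_d) e : 0 <= e ->
  (forall i, `|x ord0 i| <= e) -> `|x| <= e.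
Proof.
move=> e0 xe; rewrite [leLHS]/Num.norm /= mx_normrE.
by apply/bigmax_leP; split => // -[i j] _ /=; rewrite ord1.
Qed.

Lemma nrm_le_norm : exists2 C, 0 < C & forall x, nrm x <= C * `|x|.
Proof.
exists (1 + \sum_i nrm (delta_mx ord0 i)).
  by rewrite ltr_pwDl// sumr_ge0// => i _; exact: nrm_ge0.
move=> x; rewrite {1}[x]row_sum_delta (le_trans (nrm_sum _))//.
rewrite mulrDl mul1r ler_wpDl// mulr_suml ler_sum// => i _.
by rewrite (is_normZ hn) mulrC ler_wpM2l ?nrm_ge0// coord_le_norm.
Qed.

Lemma nrm_continuous : continuous nrm.
Proof.
have [C C0 nC] := nrm_le_norm => x; apply/(@cvgrPdist_lt _ _ _ (nbhs x)) => e e0.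
apply/nbhs_ballP; exists (e / C); first exact: divr_gt0.
move=> y; rewrite -ball_normE /= ltr_pdivlMr// mulrC => xy.
by rewrite (le_lt_trans (nrm_dist _ _))// (le_lt_trans (nC _)).
Qed.

Lemma nrmB_continuous (a : 'rV[R]_d) : continuous (fun x : 'rV[R]_d => nrm (x - a)).
Proof.
move=> y; apply: (@continuous_comp _ _ _ (fun x : 'rV[R]_d => x - a) nrm).
  by apply: (@continuousB R); [exact: cvg_id|exact: cst_continuous].
exact: nrm_continuous.
Qed.

Lemma norm_le_nrm : exists2 C, 0 < C & forall x, `|x| <= C * nrm x.
Proof.
pose S := [set x : 'rV[R]_d | `|x| = 1].
have [x0|] := pselect (S !=set0); last first.
  (* An empty sphere forces every vector to be 0, which is the case [d = 0]. *)
  move=> S0; exists 1 => // x; have [->|x0] := eqVneq x 0.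
    by rewrite normr0 nrm0 mulr0.
  exfalso; apply: S0; exists (`|x|^-1 *: x); rewrite /S/= normrZ normfV.
  by rewrite normr_id mulVf ?normr_eq0.
have Sc : compact S.
  apply: bounded_closed_compact.
    by exists 1; split => //= M M1 x ->; exact: ltW.
  have -> : S = Num.norm @^-1` [set 1] by [].
  by apply: preimage_closed (@closed_eq _ 1) => x _; exact: norm_continuous.
have cS : {within S, continuous nrm}.
  by apply: continuous_subspaceT; exact: nrm_continuous.
have [c /set_mem cS1 cmin] := EVT_min_rV x0 Sc cS.
have c0 : 0 < nrm c.
  by apply: nrm_gt0; apply: contraPneq cS1 => ->; rewrite /S /= normr0 => /esym/eqP;
     rewrite oner_eq0.
exists (nrm c)^-1; first by rewrite invr_gt0.
move=> x; have [->|x1] := eqVneq x 0; first by rewrite normr0 nrm0 mulr0.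
have nx0 : 0 < `|x| by rewrite normr_gt0.
rewrite mulrC ler_pdivlMr//.
have /cmin : (`|x|^-1 *: x) \in S.
  by apply/mem_set; rewrite /S/= normrZ normfV normr_id mulVf ?gt_eqF.
by rewrite (is_normZ hn) normfV normr_id ler_pdivlMl.
Qed.

Lemma sphere_compact : compact (unit_sphere nrm).
Proof.
have [C C0 nC] := norm_le_nrm.
apply: bounded_closed_compact.
  exists C; split => [|M CM x]; first exact: num_real.
  by rewrite /unit_sphere/= => x1; rewrite (le_trans (nC x))// x1 mulr1 ltW.
have -> : unit_sphere nrm = nrm @^-1` [set 1] by [].
by apply: preimage_closed (@closed_eq _ 1) => x _; exact: nrm_continuous.
Qed.

End norm_theory.

(** * Finite families of vectors absorbing all far points *)

Section absorbing.
Context {R : realType} {d : nat} (nrm : 'rV[R]_d -> R).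
Hypothesis hn : is_norm nrm.

Lemma sphere_covering_exists : exists k, sphere_covering nrm k.
Proof.
have := @sphere_compact R d nrm hn; rewrite compact_cover => cS.
have [|x xS|D DS SD] := cS _ (unit_sphere nrm) (fun a => [set x | nrm (x - a) < 1]).
- move=> a _; have fc := @nrmB_continuous R d nrm hn a.
  exact: ((continuousP _).1 fc _ (@open_lt R 1)).
- by exists x => //=; rewrite subrr (nrm0 hn).
- exists #|` D|, (tnth (in_tuple D)); split=> [i|x /SD[a /= aD xa]].
    by apply/set_mem/DS; exact: mem_tnth.
  have /tnthP[i ai] : a \in in_tuple D by [].
  by exists i => //; rewrite /closed_unit_ball/= -ai ltW.
Qed.

Lemma sphere_covering_numberP : sphere_covering nrm (sphere_covering_number nrm).
Proof.
have [k0 k0P] := sphere_covering_exists.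
have ex : exists k, `[< sphere_covering nrm k >] by exists k0; exact/asboolP.
case: (ex_minnP ex) => m /asboolP mP mmin.
rewrite /sphere_covering_number; set P := (X in get X).
suff [] : P (get P) by [].
apply: (@getPex _ P); exists m; split => // j jP; exact/mmin/asboolP.
Qed.

(** A tie is allowed at far points, since it contributes nothing to the bump; [b i != 0] is what
    makes the bump positive at the origin. *)
Definition absorbing n (b : 'I_n -> 'rV[R]_d) (r0 : R) :=
  (forall i, b i != 0) /\
  forall xi, r0 <= nrm xi -> exists i, nrm (xi - b i) <= nrm xi.

Lemma covering_absorbing k (a : 'I_k -> 'rV[R]_d) :
  (forall i, unit_sphere nrm (a i)) ->
  unit_sphere nrm `<=` \bigcup_(i in setT) closed_unit_ball nrm (a i) ->
  absorbing a 1.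
Proof.
move=> a1 cov; split=> [i|xi xi1].
  by apply: contraPneq (a1 i) => ->; rewrite /unit_sphere/= (nrm0 hn) => /esym/eqP;
     rewrite oner_eq0.
have xi0 : 0 < nrm xi by rewrite (lt_le_trans _ xi1).
pose u := (nrm xi)^-1 *: xi.
have u1 : nrm u = 1 by rewrite (is_normZ hn) ger0_norm ?invr_ge0 ?ltW// mulVf ?gt_eqF.
have [i _ ui] := cov u u1; exists i.
(* The first summand has norm [nrm xi - 1], because [nrm xi >= 1]; the second has norm at most 1 by
   the covering property. *)
have -> : xi - a i = (nrm xi - 1) *: u + (u - a i).
  by rewrite addrA scalerBl scale1r subrK scalerA mulfV ?gt_eqF// scale1r.
rewrite (le_trans (is_norm_triangle hn _ _))// (is_normZ hn) u1 mulr1.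
rewrite ger0_norm ?subr_ge0//; move: ui; rewrite /closed_unit_ball/=; lra.
Qed.

(** The vectors are the standard basis and minus its sum. If none of them absorbs [xi], every
    [ip xi (b i)] is bounded from above; as the [b i] add up to 0, this also bounds them from below,
    and [xi] stays in a ball. The basis need not be orthonormal for [ip], so coordinates are
    controlled by equivalence of norms. *)
Lemma euclidean_absorbing : (0 < d)%N -> euclidean_norm nrm ->
  exists b : 'I_d.+1 -> 'rV[R]_d, exists r0, absorbing b r0.
Proof.
move=> d0 [ip ipE].
have ipC x y : ip x y = ip y x.
  by have := hermC ip x y; rewrite /= expr0 mul1r.
pose b (i : 'I_d.+1) : 'rV[R]_d :=
  if unlift ord0 i is Some j then delta_mx ord0 j else - \sum_j delta_mx ord0 j.
pose S := \sum_i ip (b i) (b i).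
have ipb0 i : 0 <= ip (b i) (b i) by rewrite -ipE sqr_ge0.
have ipbS i : ip (b i) (b i) <= S.
  by rewrite /S (bigD1 i)//= lerDl sumr_ge0.
have S0 : 0 <= S by rewrite /S sumr_ge0.
have [C C0 nC] := norm_le_nrm hn.
(* [D] gathers [d] coordinates, each at most [C * nrm xi], against the bound [d.+1%:R * S] on each
   [ip xi (delta_mx ord0 j)]: a point that is not absorbed satisfies [nrm xi ^+ 2 <= D * nrm xi]. *)
pose D := d%:R * (C * (d.+1%:R * S)).
have D0 : 0 <= D by rewrite /D !mulr_ge0// ltW.
exists b, (D + 1); split.
  move=> i; rewrite /b; case: unliftP => [j _|_].
    apply/eqP => /rowP/(_ j); rewrite !mxE !eqxx/= => /eqP.
    by rewrite oner_eq0.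
  rewrite oppr_eq0; apply/eqP => /rowP/(_ (Ordinal d0)); rewrite summxE !mxE.
  rewrite (bigD1 (Ordinal d0))//= big1 ?addr0 => [|j jd]; last first.
    by rewrite mxE eqxx [_ == j]eq_sym (negbTE jd).
  by rewrite mxE !eqxx => /eqP; rewrite oner_eq0.
move=> xi xiD; apply: contrapT => /forallNP nb.
have lt_b i : 2 * ip xi (b i) < ip (b i) (b i).
  have := nb i; apply: contra_notT; rewrite -leNgt => h.
  rewrite -(@ler_pXn2r _ 2)// ?nnegrE ?nrm_ge0// !ipE linearBl !linearBr/=.
  by rewrite (ipC (b i) xi); lra.
have ub i : ip xi (b i) <= S.
  by have := lt_b i; have := ipbS i; have := ipb0 i; lra.
have ubj j : ip xi (delta_mx ord0 j) <= S.
  by have := ub (lift ord0 j); rewrite /b liftK.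
have lbs : - S <= \sum_j ip xi (delta_mx ord0 j).
  by have := ub ord0; rewrite /b unlift_none linearNr linear_sumr/= lerNl.
have lbj j : - (d.+1%:R * S) <= ip xi (delta_mx ord0 j).
  move: lbs; rewrite (bigD1 j)//= => lbs.
  have : \sum_(i | i != j) ip xi (delta_mx ord0 i) <= d%:R * S.
    apply: (@le_trans _ _ (\sum_(i < d | i != j) S)); first exact: ler_sum.
    rewrite sumr_const -[leLHS]mulr_natl ler_wpM2r// ler_nat.
    by rewrite (leq_trans (max_card _))// card_ord.
  by rewrite -natr1 mulrDl mul1r; lra.
have : nrm xi ^+ 2 <= D * nrm xi.
  rewrite ipE {2}[xi]row_sum_delta linear_sumr/= /D -!mulrA mulr_natl.
  rewrite -[X in _ *+ X]card_ord -sumr_const ler_sum// => j _.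
  rewrite linearZr/=; apply: (le_trans (ler_norm _)); rewrite normrM.
  rewrite [leRHS](_ : _ = C * nrm xi * (d.+1%:R * S)); last by ring.
  rewrite ler_pM//; first exact: le_trans (coord_le_norm _ _) (nC _).
  by rewrite ler_norml lbj/= (le_trans (ubj j))// ler_peMl// ler1n.
rewrite expr2 ler_pM2r; last by rewrite (lt_le_trans _ xiD)// ltr_wpDl.
by lra.
Qed.

Lemma absorbing_pad n m (b : 'I_n.+1 -> 'rV[R]_d) r0 : (n <= m)%N ->
  absorbing b r0 -> exists b' : 'I_m.+1 -> 'rV[R]_d, absorbing b' r0.
Proof.
move=> nm [b0 babs]; exists (fun i => b (inord (minn i n))); split => [//|xi].
move=> /babs[i xib]; exists (widen_ord (nm : (n.+1 <= m.+1)%N) i) => /=.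
by rewrite (minn_idPl _) ?inord_val// -ltnS.
Qed.

End absorbing.

(** * Continuous functions with bounded support *)

Section Rintegral_extra.
Context d {T : measurableType d} {R : realType} (mu : {measure set T -> \bar R}).
Implicit Types f g : T -> R.
Let intble f := mu.-integrable setT (EFin \o f).

Lemma integrable_dominated f g : measurable_fun setT f -> intble g ->
  (forall x, `|f x| <= g x) -> intble f.
Proof.
move=> mf ig fg; apply: le_integrable ig => //; first exact/measurable_EFinP.
by move=> x _ /=; rewrite lee_fin (le_trans (fg x))// ler_norm.
Qed.

Lemma integrable_EFinD f g : intble f -> intble g -> intble (fun x => f x + g x).
Proof.
by move=> iF iG; have := integrableD measurableT iF iG.
Qed.

Lemma integrable_EFinZl c f : intble f -> intble (fun x => c * f x).
Proof. by move=> iF; have := integrableZl measurableT c iF. Qed.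

Lemma integrable_EFinB f g : intble f -> intble g -> intble (fun x => f x - g x).
Proof.
move=> iF iG; have := integrable_EFinD iF (integrable_EFinZl (-1) iG).
by under eq_fun do rewrite mulN1r.
Qed.

Lemma integrable_EFin_sum (I : Type) (s : seq I) (F : I -> T -> R) :
  (forall i, intble (F i)) -> intble (fun x => \sum_(i <- s) F i x).
Proof.
move=> iF; elim: s => [|i s ih].
  under eq_fun do rewrite big_nil.
  exact: integrable0.
by under eq_fun do rewrite big_cons; exact: integrable_EFinD.
Qed.

Lemma Rintegral_sum (I : Type) (s : seq I) (F : I -> T -> R) :
  (forall i, intble (F i)) ->
  \int[mu]_x (\sum_(i <- s) F i x) = \sum_(i <- s) \int[mu]_x F i x.
Proof.
move=> iF; elim: s => [|i s ih].
  under eq_Rintegral do rewrite big_nil.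
  by rewrite big_nil Rintegral_cst// mul0r.
under eq_Rintegral do rewrite big_cons.
rewrite big_cons RintegralD ?ih//; first exact: iF.
exact: (integrable_EFin_sum s iF).
Qed.

Lemma Rintegral_dominated_cvg0 (f : nat -> T -> R) (g : T -> R) :
  (forall n, measurable_fun setT (f n)) -> intble g ->
  (forall n x, `|f n x| <= g x) -> (forall x, f ^~ x @ \oo --> (0 : R)) ->
  (fun n => \int[mu]_x f n x) @ \oo --> (0 : R).
Proof.
move=> mf ig fg f0.
have : (fun n => (\int[mu]_x (f n x)%:E)%E) @ \oo --> (\int[mu]_x (cst 0 x))%E.
  apply: (@dominated_cvg _ _ _ mu setT measurableT _ _ (EFin \o g)) => //.
  - by move=> n; apply/measurable_EFinP.
  - by move=> x _; apply: cvg_EFin; [exact: nearW|exact: f0].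
  - by move=> n x _; rewrite lee_fin.
by rewrite integral0 => /fine_cvg.
Qed.

End Rintegral_extra.

Lemma Rintegral_probability_cst {dd : measure_display} {T : measurableType dd}
    {R : realType} (mu : probability T R) (c : R) : \int[mu]_x c = c.
Proof. by rewrite Rintegral_cst// [X in fine X](@probability_setT _ _ _ mu) mulr1. Qed.

Section sums.
Context {R : realType} {I : Type}.

Lemma cvg_sumr {T : Type} {F : set_system T} {FF : Filter F} (s : seq I)
    (f : I -> T -> R) (l : I -> R) : (forall i, f i @ F --> l i) ->
  (fun x => \sum_(i <- s) f i x) @ F --> \sum_(i <- s) l i.
Proof.
by move=> fl; apply: cvg_big => //; exact: add_continuous.
Qed.

Lemma continuous_sumr {T : topologicalType} (s : seq I) (f : I -> T -> R) :
  (forall i, continuous (f i)) -> continuous (fun x => \sum_(i <- s) f i x).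
Proof. by move=> cf x; apply: cvg_sumr => i; exact: cf. Qed.

Lemma continuous_mulr {T : topologicalType} (f g : T -> R) :
  continuous f -> continuous g -> continuous (fun x => f x * g x).
Proof. by move=> cf cg x; apply: continuousM; [exact: cf|exact: cg]. Qed.

Lemma continuous_maxr {T : topologicalType} (f g : T -> R) :
  continuous f -> continuous g -> continuous (fun x => Num.max (f x) (g x)).
Proof. by move=> cf cg x; apply: continuous_max; [exact: cf|exact: cg]. Qed.

Lemma continuous_subr {T : topologicalType} (f g : T -> R) :
  continuous f -> continuous g -> continuous (fun x => f x - g x).
Proof. by move=> cf cg x; apply: continuousB; [exact: cf|exact: cg]. Qed.

Lemma continuous_cst {T : topologicalType} (c : R) : continuous (fun _ : T => c).
Proof. by move=> x; exact: cst_continuous. Qed.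

End sums.

Section continuous_measurable.
Context {R : realType} {d : nat}.
Implicit Types (f g : 'rV[R]_d -> R) (mu : probability (borelRd R d) R).

Lemma continuous_borel f : continuous f ->
  measurable_fun setT (f : borelRd R d -> R).
Proof.
move=> /continuousP cf; apply: (measurability _ (RGenOpens.measurableE R)).
move=> _ [_ [a [b ->] <-]]; rewrite setTI.
by apply: sub_sigma_algebra; exact/cf/interval_open.
Qed.

Lemma integrable_bounded mu f M : continuous f -> (forall x, `|f x| <= M) ->
  mu.-integrable setT (EFin \o f).
Proof.
move=> cf fM; apply: (@integrable_dominated _ _ _ _ _ (cst M)) => //.
  exact: continuous_borel.
exact: finite_measure_integrable_cst.
Qed.

Lemma le_Rintegral_bounded mu f M : continuous f -> (forall x, `|f x| <= M) ->
  `|\int[mu]_x f x| <= M.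
Proof.
move=> cf fM; have iF := integrable_bounded mu cf fM.
apply: (le_trans (le_normr_Rintegral _ _)) => //.
rewrite -[leRHS](Rintegral_probability_cst mu); apply: le_Rintegral => //.
  exact: (integrable_norm (mu := mu)).
exact: finite_measure_integrable_cst.
Qed.

End continuous_measurable.

Section bounded_support.
Context {R : realType} {d : nat}.
Implicit Types (f g : 'rV[R]_d -> R) (mu : probability (borelRd R d) R).

Definition bounded_support f := exists T : R, forall x, T <= `|x| -> f x = 0.

Lemma bounded_supportB f g : bounded_support f -> bounded_support g ->
  bounded_support (fun x => f x - g x).
Proof.
move=> [T fT] [S gS]; exists (Num.max T S) => x.
by rewrite ge_max => /andP[/fT -> /gS ->]; rewrite subrr.
Qed.

Lemma bounded_supportMl f g : bounded_support f ->
  bounded_support (fun x => g x * f x).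
Proof. by move=> [T fT]; exists T => x /fT ->; rewrite mulr0. Qed.

Lemma bounded_support_sum (I : Type) (s : seq I) (F : I -> 'rV[R]_d -> R) :
  (forall i, bounded_support (F i)) ->
  bounded_support (fun x => \sum_(i <- s) F i x).
Proof.
move=> bF; elim: s => [|i s [S hS]].
  by exists 0 => x _; rewrite big_nil.
have [T hT] := bF i; exists (Num.max T S) => x.
by rewrite ge_max => /andP[/hT + /hS]; rewrite big_cons => -> ->; rewrite addr0.
Qed.

Lemma continuous_bounded_support_bounded f : continuous f -> bounded_support f ->
  exists2 M, 0 < M & forall x, `|f x| <= M.
Proof.
move=> cf [T fT].
(* [T] may be negative; the maximum with 0 keeps the ball nonempty. *)
pose K := [set x : 'rV[R]_d | `|x| <= Num.max 0 T].
have Kc : compact K.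
  apply: bounded_closed_compact.
    exists (Num.max 0 T); split; first exact: num_real.
    by move=> M TM x /= /le_trans; apply; exact: ltW.
  have -> : K = Num.norm @^-1` [set t | t <= Num.max 0 T] by [].
  by apply: preimage_closed (@closed_le _ _) => x _; exact: norm_continuous.
have cfK : {within K, continuous (fun x => `|f x|)}.
  apply: continuous_subspaceT => x.
  by apply: continuous_comp; [exact: cf|exact: norm_continuous].
have [|c _ cmax] := EVT_max_rV _ Kc cfK.
  by exists 0; rewrite /K/= normr0 le_max lexx.
exists (1 + `|f c|); first by rewrite ltr_pwDl.
move=> x; have [xT|xT] := leP `|x| (Num.max 0 T).
  by rewrite ler_wpDl// cmax//; exact/mem_set.
rewrite fT ?normr0 ?addr_ge0//; move/ltW: xT.
by rewrite ge_max => /andP[].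
Qed.

Lemma continuous_bounded_support_integrable mu f :
  continuous f -> bounded_support f -> mu.-integrable setT (EFin \o f).
Proof.
move=> cf bf; have [M _ fM] := continuous_bounded_support_bounded cf bf.
exact: integrable_bounded fM.
Qed.

Lemma heine_cantor f : continuous f -> bounded_support f ->
  forall e, 0 < e -> exists2 a, 0 < a &
    forall x y, `|x - y| < a -> `|f x - f y| < e.
Proof.
move=> cf [T fT] e e0.
(* The ball exceeds the support by 1: for [a < 1], if [x] lies outside it and [y] is within [a] of
   [x], then [f] vanishes at both points. *)
pose K := [set x : 'rV[R]_d | `|x| <= T + 1].
have Kc : compact K.
  apply: bounded_closed_compact.
    exists (T + 1); split; first exact: num_real.
    by move=> M TM x /= /le_trans; apply; exact: ltW.
  have -> : K = Num.norm @^-1` [set t | t <= T + 1] by [].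
  by apply: preimage_closed (@closed_le _ _) => x _; exact: norm_continuous.
have : \forall a \near 0^'+, K `<=`
    [set x | forall y, `|x - y| < a -> `|f x - f y| < e].
  apply: ((compact_near_coveringP _).1 Kc) => x _.
  have : nbhs x [set y | `|f x - f y| < e / 2].
    move/(_ x): cf => /(@cvgrPdist_lt _ _ _ (nbhs x)); apply.
    exact: divr_gt0.
  move=> /nbhs_ballP[r /= r0 hr].
  exists (ball x (r / 2), [set a | 0 < a < r / 2]) => /=.
    split; first by apply: nbhsx_ballx; exact: divr_gt0.
    by near=> a; apply/andP; split; near: a;
      [exact: nbhs_right_gt|apply: nbhs_right_lt; exact: divr_gt0].
  move=> [x' a] /= [xx' /andP[a0 ar]] y x'y.
  move: xx'; rewrite -ball_normE /= => xx'.
  have h1 : `|f x - f x'| < e / 2.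
    by apply: hr; rewrite -ball_normE /= (lt_trans xx')// ltr_pdivrMr// ltr_pMr// ltr1n.
  have h2 : `|f x - f y| < e / 2.
    apply: hr; rewrite -ball_normE /= -(subrKA x') (le_lt_trans (ler_normD _ _))//.
    by rewrite (splitr r) ltrD// (lt_trans x'y).
  rewrite -(subrKA (f x)) (le_lt_trans (ler_normD _ _))// (splitr e) ltrD//.
  by rewrite distrC.
move=> Ha; have : \forall a \near 0^'+, 0 < a /\ a < 1 /\ K `<=`
    [set x | forall y, `|x - y| < a -> `|f x - f y| < e].
  by near=> a; split; [|split]; near: a;
    [exact: nbhs_right_gt|exact: nbhs_right_lt|exact: Ha].
move=> /filter_ex[a [a0 [a1 aK]]].
exists a => // x y xy; have [xT|xT] := leP `|x| (T + 1); first exact: (aK x).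
rewrite fT; last by rewrite ltW// (lt_trans _ xT)// ltrDl.
rewrite fT ?subrr ?normr0//.
have := ler_normB x (x - y); rewrite opprB addrC subrK => h.
by have := ler_normD (x - y) y; rewrite subrK; lra.
Unshelve. all: by end_near. Qed.

End bounded_support.

(** * Density of the span of the translates and dilates of a bump *)

Lemma eq_mod_close (L a b : nat) : (a < b + L)%N -> (b < a + L)%N ->
  a = b %[mod L] -> a = b.
Proof.
wlog ab : a b / (a <= b)%N.
  move=> H l1 l2 m; have [|ba] := leqP a b; first by move/H; exact.
  by apply/esym; apply: H => //; exact: ltnW.
move=> _ baL /esym/eqP; rewrite eqn_mod_dvd// => dv.
have [ba0|pos] := posnP (b - a)%N; first by lia.
by have := dvdn_leq pos dv; lia.
Qed.

Section lattice.
Context {R : realType} {d : nat}.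

(** The shift by [n] lets natural indices reach negative coordinates: for [m = (n + n).+1] these are
    the points of hZ^d in the cube of half-side hn. *)
Definition lattice_point (n m : nat) (h : R) (i : {ffun 'I_d -> 'I_m}) : 'rV[R]_d :=
  \row_j (h * ((i j)%:R - n%:R)).

(** Two lattice points within [w] of [x] have indices that differ by less than [L.+1] in each
    coordinate, so reducing the indices modulo [L.+1] is injective on the set. *)
Lemma card_lattice_overlap (n m L : nat) (h w : R) (x : 'rV[R]_d) :
  0 < h -> 2 * w <= L.+1%:R * h ->
  (#|[set i : {ffun 'I_d -> 'I_m} | (`|x - lattice_point n h i| < w)%R]%SET| <= L.+1 ^ d)%N.
Proof.
move=> h0 wL; set S := finset _.
pose g (i : {ffun 'I_d -> 'I_m}) : {ffun 'I_d -> 'I_L.+1} :=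
  [ffun j => inord (i j %% L.+1)].
have g_inj : {in S &, injective g}.
  move=> i1 i2; rewrite !inE => h1 h2 g12; apply/ffunP => j; apply/val_inj => /=.
  have mod12 : i1 j = i2 j %[mod L.+1].
    move/ffunP/(_ j): g12; rewrite !ffunE => /(congr1 val) /=.
    by rewrite !inordK ?ltn_pmod.
  have dist (i : {ffun 'I_d -> 'I_m}) : `|x - lattice_point n h i| < w ->
      `|x ord0 j - h * ((i j)%:R - n%:R)| < w.
    apply: le_lt_trans; have := coord_le_norm (x - lattice_point n h i) j.
    by rewrite !mxE.
  have := dist _ h1; have := dist _ h2.
  rewrite !ltr_norml => /andP[l2 u2] /andP[l1 u1].
  have : `|(i1 j)%:R - (i2 j)%:R| * h < L.+1%:R * h :> R.
    rewrite -{1}(gtr0_norm h0) -normrM; apply: lt_le_trans wL.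
    by rewrite ltr_norml; apply/andP; split; lra.
  rewrite ltr_pM2r// ltr_norml => /andP[ll uu].
  have lt1 : (i1 j < i2 j + L.+1)%N by rewrite -(ltr_nat R) natrD; lra.
  have lt2 : (i2 j < i1 j + L.+1)%N by rewrite -(ltr_nat R) natrD; lra.
  exact: eq_mod_close lt1 lt2 mod12.
rewrite -(card_in_imset g_inj) (leq_trans (max_card _))//.
by rewrite card_ffun !card_ord.
Qed.

Lemma lattice_dense (n : nat) (h : R) (x : 'rV[R]_d) : 0 < h -> `|x| <= h * n%:R ->
  exists i : {ffun 'I_d -> 'I_(n + n).+1}, `|x - lattice_point n h i| <= h.
Proof.
move=> h0 xn.
(* Each coordinate is rounded down to a multiple of [h]. *)
pose z j : int := Num.floor (x ord0 j / h) + n%:Z.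
have zP j : 0 <= z j <= (n + n)%:Z.
  have : `|x ord0 j / h| <= n%:R.
    rewrite normrM normfV (gtr0_norm h0) ler_pdivrMr// mulrC.
    exact: le_trans (coord_le_norm _ _) xn.
  rewrite ler_norml => /andP[l u]; rewrite /z; apply/andP; split.
    by rewrite -lerBlDr sub0r floor_ge_int// mulrNz.
  rewrite PoszD lerD2r -(ler_int R); apply: le_trans u.
  exact: floor_le.
exists [ffun j => inord `|z j|%N]; apply: norm_le_coord; first exact: ltW.
move=> j; rewrite !mxE ffunE inordK; last first.
  by move: (zP j); lia.
have -> : (`|z j|%N)%:R - n%:R = (Num.floor (x ord0 j / h))%:~R :> R.
  rewrite natr_absz ger0_norm; last by case/andP: (zP j).
  by rewrite /z intrD addrK.
have l := floor_le (x ord0 j / h); have u := floorD1_gt (x ord0 j / h).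
move: l u; rewrite intrD; set fl := (Num.floor _)%:~R => l u.
rewrite ler_pdivlMr// in l; rewrite ltr_pdivrMr// in u.
rewrite ger0_norm; nra.
Qed.

End lattice.

Section bump.
Context {R : realType} {d : nat}.
Variable phi : 'rV[R]_d -> R.
Hypotheses (cphi : continuous phi) (phi_ge0 : forall x, 0 <= phi x)
  (phi0 : 0 < phi 0) (bphi : bounded_support phi).

Let bump (a : 'rV[R]_d) (r : R) (x : 'rV[R]_d) := phi (r^-1 *: (x - a)).

(** With coefficients [f (a i) / C], the error is [f x * (1 - Phi / C)] plus an oscillation term,
    where [Phi] is the sum of the bumps. [Phi <= C] everywhere and [Phi >= c0] where [f] may be
    nonzero, so the first part is at most [(1 - c0 / C) * M]; uniform continuity makes the second
    cost at most half of that gain. *)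
Lemma bump_approx_step : exists2 th, 0 < th < 1 &
  forall f, continuous f -> bounded_support f ->
  forall M, 0 < M -> (forall x, `|f x| <= M) ->
  exists (I : finType) (c : I -> R) (a : I -> 'rV[R]_d) (r : R), 0 < r /\
    forall x, `|f x - \sum_i c i * bump (a i) r x| <= th * M.
Proof.
have [B B0 phiB] := continuous_bounded_support_bounded cphi bphi.
have [K0 hK0] := bphi.
pose K := Num.max 1 K0.
have K1 : 1 <= K by rewrite /K le_max lexx.
have hK x : K <= `|x| -> phi x = 0 by rewrite /K ge_max => /andP[_ /hK0].
have [dl dl0 hdl] : exists2 dl, 0 < dl & forall x, `|x| <= dl -> phi 0 / 2 <= phi x.
  have : nbhs (0 : 'rV[R]_d) [set y | `|phi 0 - phi y| < phi 0 / 2].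
    exact: ((cvgrPdist_lt _ _).1 (@cphi (0 : 'rV[R]_d)) _ (divr_gt0 phi0 (ltr0Sn _ 1))).
  move=> /nbhs_ballP[r /= r0 hr]; exists (r / 2); first exact: divr_gt0.
  move=> x xr; have : `|phi 0 - phi x| < phi 0 / 2.
    apply: hr; rewrite -ball_normE /= sub0r normrN (le_lt_trans xr)//.
    by rewrite ltr_pdivrMr// ltr_pMr// ltr1n.
  by rewrite ltr_norml => /andP[]; lra.
pose c0 := phi 0 / 2.
have c00 : 0 < c0 by rewrite divr_gt0.
(* Support radius [K * r] is compared with lattice spacing [dl * r]: the dilation cancels, so that
   [L], [C] and the contraction factor depend on [phi] only. *)
pose L := `|Num.ceil (2 * K / dl)|%N.
have LP : 2 * K <= L.+1%:R * dl.
  rewrite -ler_pdivrMr//; apply: (@le_trans _ _ L%:R); last by rewrite ler_nat.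
  apply: (le_trans (ceil_ge _)); rewrite /L natr_absz ler_int.
  by rewrite ler_norm.
pose C := (L.+1 ^ d)%:R * B.
have C0 : 0 < C by rewrite mulr_gt0// ltr0n expn_gt0.
have c0C : c0 <= C.
  rewrite /C -[leLHS]mul1r ler_pM ?(ltW c00)// ?ler1n ?expn_gt0//.
  by have := phiB 0; have := phi0; rewrite ger0_norm// /c0; lra.
have cC0 : 0 < c0 / C by rewrite divr_gt0.
have cC1 : c0 / C <= 1 by rewrite ler_pdivrMr// mul1r.
exists (1 - c0 / C / 2); first by apply/andP; split; lra.
move=> f cf bf M M0 fM; have [T fT] := bf.
have e0 : 0 < c0 / C / 2 * M by rewrite mulr_gt0// divr_gt0.
have [eta eta0 heta] := heine_cantor cf bf e0.
(* With this dilation a bump vanishes at distance [eta] or more from its centre, where [eta] is the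
   modulus of continuity of [f]. *)
pose r := eta / K.
have r0 : 0 < r by rewrite divr_gt0// (lt_le_trans _ K1).
pose h := dl * r.
have h0 : 0 < h by rewrite mulr_gt0.
pose n := `|Num.ceil (T / h)|%N.
have nP : T <= h * n%:R.
  rewrite mulrC -ler_pdivrMr// (le_trans (ceil_ge _))// /n natr_absz ler_int.
  by rewrite ler_norm.
pose I := {ffun 'I_d -> 'I_(n + n).+1}.
pose a (i : I) := lattice_point n h i.
exists I, (fun i => f (a i) / C), a, r; split => // x.
have bump_near i : bump (a i) r x != 0 -> `|x - a i| < eta.
  apply: contraNT; rewrite -leNgt => le; apply/eqP/hK.
  rewrite normrZ normfV (gtr0_norm r0) ler_pdivlMl// /r.
  by rewrite mulfVK// gt_eqF// (lt_le_trans _ K1).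
pose Phi := \sum_i bump (a i) r x.
have Phi0 : 0 <= Phi by apply: sumr_ge0 => i _; exact: phi_ge0.
have PhiC : Phi <= C.
  rewrite /Phi (bigID [pred i | `|x - a i| < eta])/= [X in _ + X]big1 ?addr0; last first.
    by move=> i /negP ni; apply/eqP/negPn/negP => /bump_near.
  apply: (@le_trans _ _ (\sum_(i | `|x - a i| < eta) B)).
    by apply: ler_sum => i _; have := phiB (r^-1 *: (x - a i)); rewrite ger0_norm.
  rewrite sumr_const /C -[leLHS]mulr_natl ler_wpM2r ?(ltW B0)// ler_nat.
  have : 2 * eta <= L.+1%:R * h.
    rewrite /h mulrA (le_trans _ (ler_wpM2r (ltW r0) LP))// /r -mulrA ler_wpM2l//.
    by rewrite mulrC mulfVK// gt_eqF// (lt_le_trans _ K1).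
  move=> /(@card_lattice_overlap R d n (n + n).+1 L h eta x h0).
  by rewrite cardsE.
have -> : f x - \sum_i f (a i) / C * bump (a i) r x =
    f x * (1 - Phi / C) + (\sum_i (f x - f (a i)) * bump (a i) r x) / C.
  rewrite mulrBr mulr1 -addrA; congr (_ + _).
  rewrite /Phi !mulr_suml mulr_sumr -sumrN -sumrN -big_split/=.
  by apply: eq_bigr => i _; field; rewrite gt_eqF.
have -> : (1 - c0 / C / 2) * M = M * (1 - c0 / C) + c0 / C / 2 * M by lra.
rewrite (le_trans (ler_normD _ _))// lerD//.
  have PhiC1 : 0 <= 1 - Phi / C by rewrite subr_ge0 ler_pdivrMr// mul1r.
  rewrite normrM (ger0_norm PhiC1).
  have [xT|xT] := leP T `|x|.
    by rewrite fT// normr0 mul0r mulr_ge0// ?(ltW M0)// subr_ge0.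
  have [i hi] := lattice_dense h0 (le_trans (ltW xT) nP).
  rewrite ler_pM// lerD2l lerN2 ler_pM2r ?invr_gt0//.
  rewrite /Phi (bigD1 i)//= ler_wpDr//.
    by apply: sumr_ge0 => j _; exact: phi_ge0.
  apply: hdl; rewrite normrZ normfV (gtr0_norm r0) ler_pdivrMl//.
  by rewrite mulrC.
rewrite normrM normfV (gtr0_norm C0) ler_pdivrMr//.
rewrite (le_trans (ler_norm_sum _ _ _))//.
apply: (@le_trans _ _ (c0 / C / 2 * M * Phi)); last by rewrite (ler_wpM2l (ltW e0)).
rewrite /Phi mulr_sumr ler_sum// => i _; rewrite normrM (ger0_norm (phi_ge0 _)).
rewrite -/(bump (a i) r x).
have [->|/bump_near/heta/ltW] := eqVneq (bump (a i) r x) 0; first by rewrite !mulr0.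
by move=> le; rewrite ler_wpM2r// phi_ge0.
Qed.

Variables (mu : nat -> probability (borelRd R d) R) (nu : probability (borelRd R d) R).
Hypothesis cvg_bump : forall a r, 0 < r ->
  (fun n => \int[mu n]_x bump a r x) @ \oo --> \int[nu]_x bump a r x.

Lemma bump_continuous a r : continuous (bump a r).
Proof.
move=> x; apply: (@continuous_comp _ _ _ (fun x : 'rV[R]_d => r^-1 *: (x - a)) phi).
  apply: (@continuousZl_tmp R); apply: (@continuousB R); [exact: cvg_id|exact: cst_continuous].
exact: cphi.
Qed.

Lemma bump_bounded_support a r : 0 < r -> bounded_support (bump a r).
Proof.
move=> r0; have [K hK] := bphi; exists (r * K + `|a|) => x xK; apply: hK.
rewrite normrZ normfV (gtr0_norm r0) ler_pdivlMl//.
by rewrite -lerBrDr in xK; rewrite (le_trans xK)// lerB_dist.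
Qed.

(* Applying the one-step approximation k times multiplies the sup norm of the
   error by th ^+ k. *)
Lemma cvg_bounded_support f : continuous f -> bounded_support f ->
  (fun n => \int[mu n]_x f x) @ \oo --> \int[nu]_x f x.
Proof.
have [th /andP[th0 th1] step] := bump_approx_step.
(* The claim ranges over all [f] because the induction passes from [f] to the error [f - g]; the
   case [k = 0] is the trivial bound for probability measures. *)
have iter k : forall f, continuous f -> bounded_support f ->
  forall M, 0 < M -> (forall x, `|f x| <= M) ->
  forall e, 0 < e ->
  \forall n \near \oo, `|\int[nu]_x f x - \int[mu n]_x f x| <= 2 * M * th ^+ k + e.
  elim: k => [|k ih] {}f cf bf M M0 fM e e0.
    near=> n; rewrite expr0 mulr1 (le_trans (ler_normB _ _))// ler_wpDr ?(ltW e0)//.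
    by rewrite mulr_natl mulr2n lerD//; exact: le_Rintegral_bounded.
  have [I [c [a [r [r0 fg]]]]] := step f cf bf M M0 fM.
  pose g x := \sum_i c i * bump (a i) r x.
  have cbump i : continuous (fun x => c i * bump (a i) r x).
    by move=> x; apply: continuousM; [exact: cst_continuous|exact: bump_continuous].
  have cg : continuous g.
    exact: continuous_sumr.
  have bbump i : bounded_support (fun x => c i * bump (a i) r x).
    by apply: bounded_supportMl; exact: bump_bounded_support.
  have bg : bounded_support g by exact: bounded_support_sum.
  have Eg (m : probability (borelRd R d) R) :
      \int[m]_x g x = \sum_i c i * \int[m]_x bump (a i) r x.
    rewrite /g Rintegral_sum => [|i]; last exact: continuous_bounded_support_integrable.
    apply: eq_bigr => i _; rewrite RintegralZl//.
    apply: continuous_bounded_support_integrable; first exact: bump_continuous.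
    exact: bump_bounded_support.
  have cvg_g : (fun n => \int[mu n]_x g x) @ \oo --> \int[nu]_x g x.
    rewrite Eg; under eq_fun do rewrite Eg.
    by apply: cvg_sumr => i; apply: cvgMl_tmp; exact: cvg_bump.
  have cfg : continuous (fun x => f x - g x).
    by move=> x; apply: (@continuousB R); [exact: cf|exact: cg].
  have bfg : bounded_support (fun x => f x - g x) by exact: bounded_supportB.
  have Mth : 0 < th * M by rewrite mulr_gt0.
  have e2 : 0 < e / 2 by rewrite divr_gt0.
  have ih' := ih _ cfg bfg _ Mth fg _ e2.
  move/cvgrPdist_le : cvg_g => /(_ _ e2) cvg_g.
  near=> n.
  have Efg (m : probability (borelRd R d) R) :
      \int[m]_x f x = \int[m]_x (f x - g x) + \int[m]_x g x.
    by rewrite RintegralB ?subrK//; exact: continuous_bounded_support_integrable.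
  rewrite !Efg opprD addrACA (le_trans (ler_normD _ _))//.
  rewrite (splitr e) addrA lerD//; last by near: n; exact: cvg_g.
  rewrite exprS mulrA -[2 * M * th]mulrA [M * th]mulrC.
  by near: n; exact: ih'.
move=> cf bf; have [M M0 fM] := continuous_bounded_support_bounded cf bf.
apply/cvgrPdist_le => e e0.
have e2 : 0 < e / 2 by rewrite divr_gt0.
have : (fun k => 2 * M * th ^+ k) @ \oo --> 2 * M * 0.
  by apply: cvgMl_tmp; apply: cvg_expr; rewrite gtr0_norm.
rewrite mulr0 => /cvgrPdist_lt/(_ _ e2)/filter_ex[k].
rewrite sub0r normrN => hk.
have := iter k f cf bf M M0 fM _ e2; apply: filterS => n /le_trans; apply.
by rewrite [leRHS]splitr lerD// (le_trans (ler_norm _))// ltW.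
Unshelve. all: by end_near. Qed.

End bump.

(** * Quantizers *)

Section quantizer.
Context {R : realType} {d : nat} {nrm : 'rV[R]_d -> R}.
Hypothesis hn : is_norm nrm.
Variable p : R.
Hypothesis hp : 1 <= p.
Let p0 : 0 < p := lt_le_trans ltr01 hp.

(** Seeding the minimum with one of its own terms keeps it in [R]; hence the size [n.+1]. *)
Definition dist_min n (x : {ffun 'I_n.+1 -> 'rV[R]_d}) (xi : 'rV[R]_d) : R :=
  \big[Num.min/nrm (xi - x ord0)]_i nrm (xi - x i).

Section one.
Variables (n : nat) (x : {ffun 'I_n.+1 -> 'rV[R]_d}).
Implicit Types xi eta : 'rV[R]_d.

Lemma dist_min_le xi i : dist_min x xi <= nrm (xi - x i).
Proof. exact: bigmin_le. Qed.

Lemma dist_min_attained xi : exists i, dist_min x xi = nrm (xi - x i).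
Proof.
rewrite /dist_min; elim/big_ind: _ => [|a b [i ->] [j ->]|i _]; last by exists i.
  by exists ord0.
by case: leP => _; [exists i|exists j].
Qed.

Lemma dist_min_ge0 xi : 0 <= dist_min x xi.
Proof. by have [i ->] := dist_min_attained xi; exact: nrm_ge0. Qed.

Lemma dist_min_lipschitz xi eta : dist_min x xi <= dist_min x eta + nrm (xi - eta).
Proof.
have [i ->] := dist_min_attained eta.
by rewrite (le_trans (dist_min_le _ i))// [leRHS]addrC (nrm_triangleB hn).
Qed.

Lemma dist_min_powR xi : (\big[mine/+oo]_(i < n.+1) ((nrm (xi - x i)) `^ p)%:E =
  (dist_min x xi `^ p)%:E)%E.
Proof.
apply/eqP; rewrite eq_le; apply/andP; split.
  by have [i ->] := dist_min_attained xi; exact: bigmin_le.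
apply: le_bigmin => [|i _]; first exact: leey.
by rewrite lee_fin le_powR// ?dist_min_ge0 ?dist_min_le// ltW.
Qed.

Lemma dist_min_continuous : continuous (dist_min x).
Proof.
have [C C0 nC] := nrm_le_norm hn.
move=> xi; apply/(@cvgrPdist_lt _ _ _ (nbhs xi)) => e e0.
apply/nbhs_ballP; exists (e / C); first exact: divr_gt0.
move=> y; rewrite -ball_normE /= ltr_pdivlMr// mulrC => xy.
have h : nrm (xi - y) < e by exact: le_lt_trans (nC _) xy.
have h1 := dist_min_lipschitz xi y; have h2 := dist_min_lipschitz y xi.
by rewrite (nrmB hn y) in h2; rewrite ltr_norml; apply/andP; split; lra.
Qed.

Lemma dist_min_powR_continuous : continuous (fun xi => dist_min x xi `^ p).
Proof.
move=> xi; apply: (cvg_powR (F := nbhs xi) (f := dist_min x) p0 dist_min_ge0 (dist_min_ge0 _)).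
exact: dist_min_continuous.
Qed.

End one.

Lemma nrm_powR_continuous : continuous (fun xi => nrm xi `^ p).
Proof.
move=> xi; apply: (cvg_powR (F := nbhs xi) (f := nrm) p0 (nrm_ge0 hn) (nrm_ge0 hn _)).
exact: nrm_continuous.
Qed.

Lemma finite_moment_integrable (mu : probability (borelRd R d) R) :
  finite_moment nrm p mu -> mu.-integrable setT (EFin \o (fun xi => nrm xi `^ p)).
Proof.
move=> fm; apply/integrableP; split.
  apply/measurable_EFinP; exact: continuous_borel nrm_powR_continuous.
apply: le_lt_trans fm; rewrite le_eqVlt; apply/orP; left; apply/eqP.
by apply: eq_integral => z _ /=; rewrite ger0_norm// powR_ge0.
Qed.

Lemma dist_min_integrable (mu : probability (borelRd R d) R) n
    (x : {ffun 'I_n.+1 -> 'rV[R]_d}) : finite_moment nrm p mu ->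
  mu.-integrable setT (EFin \o (fun xi => dist_min x xi `^ p)).
Proof.
move=> /finite_moment_integrable fm.
apply: (@integrable_dominated _ _ _ _ _
  (fun xi : borelRd R d => 2 `^ p * (nrm (x ord0) `^ p + nrm xi `^ p))).
- exact: continuous_borel (dist_min_powR_continuous (x := x)).
- apply: integrable_EFinZl; apply: integrable_EFinD => //.
  exact: finite_measure_integrable_cst.
- move=> xi; rewrite ger0_norm ?powR_ge0//.
  have := powRD_le (ltW p0) (nrm_ge0 hn (x ord0)) (nrm_ge0 hn xi).
  apply: le_trans; apply: le_powR; rewrite ?(ltW p0) ?dist_min_ge0//.
  rewrite (le_trans (dist_min_le x xi ord0))// addrC -[nrm (x ord0)](nrmN hn).
  exact: is_norm_triangle.
Qed.

Lemma quant_errorE (mu : probability (borelRd R d) R) n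
    (x : {ffun 'I_n.+1 -> 'rV[R]_d}) : finite_moment nrm p mu ->
  quant_error nrm p mu x = (\int[mu]_xi (dist_min x xi `^ p)) `^ p^-1.
Proof.
move=> fm; have iF := dist_min_integrable x fm.
rewrite /quant_error; under eq_integral do rewrite dist_min_powR.
by rewrite -[X in (X `^ _)%E]fineK ?poweR_EFin//; exact: integrable_fin_num.
Qed.

(** Removing the p-th root gives a quantity linear in the measure, for which differences of two
    quantizers make sense as integrals of differences. *)
Lemma cvg_quant_error_Rintegral (mu : nat -> probability (borelRd R d) R)
    (nu : probability (borelRd R d) R) n (x : {ffun 'I_n.+1 -> 'rV[R]_d}) :
  (forall n, (1 <= n)%N -> finite_moment nrm p (mu n)) -> finite_moment nrm p nu ->
  (fun n => quant_error nrm p (mu n) x) @ \oo --> quant_error nrm p nu x ->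
  (fun n => \int[mu n]_xi (dist_min x xi `^ p)) @ \oo -->
    \int[nu]_xi (dist_min x xi `^ p).
Proof.
move=> fmu fnu.
have I0 (m : probability (borelRd R d) R) : 0 <= \int[m]_xi (dist_min x xi `^ p).
  by apply: Rintegral_ge0 => xi _; exact: powR_ge0.
rewrite quant_errorE// => cv.
have : (fun n => quant_error nrm p (mu n) x `^ p) @ \oo -->
    ((\int[nu]_xi (dist_min x xi `^ p)) `^ p^-1) `^ p.
  apply: cvg_powR cv; rewrite ?powR_ge0// => m.
  by rewrite fine_ge0// poweR_ge0.
rewrite powRVK//; apply: cvg_trans; apply: near_eq_cvg.
(* No moment is assumed for [mu 0], so the sequences are compared from index 1 on. *)
by exists 1 => //= m m1; rewrite quant_errorE ?powRVK//; exact: fmu.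
Qed.

End quantizer.
Arguments dist_min {R d} nrm {n} x xi.

(** * The bump obtained by adding a centre to a quantizer *)

Section quantizer_bump.
Context {R : realType} {d : nat} {nrm : 'rV[R]_d -> R}.
Hypothesis hn : is_norm nrm.
Variable p : R.
Hypothesis hp : 1 <= p.
Let p0 : 0 < p := lt_le_trans ltr01 hp.
Variables (n : nat) (b : 'I_n.+1 -> 'rV[R]_d) (r0 : R).
Hypothesis babs : absorbing nrm b r0.

Let q := [ffun i => b i].

(** This is the drop of the integrand when the point 0 joins the quantizer [b]: it is nonzero only
    where 0 is strictly the nearest point. *)
Definition quantizer_bump (xi : 'rV[R]_d) : R :=
  Num.max 0 (dist_min nrm q xi `^ p - nrm xi `^ p).

Lemma quantizer_bump_continuous : continuous quantizer_bump.
Proof.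
move=> xi; apply: (@continuous_comp _ _ _
  (fun xi => dist_min nrm q xi `^ p - nrm xi `^ p) (Num.max 0)).
  apply: (@continuousB R); first exact: dist_min_powR_continuous.
  exact: nrm_powR_continuous.
by apply: continuous_max; [exact: cst_continuous|exact: cvg_id].
Qed.

Lemma quantizer_bump_ge0 xi : 0 <= quantizer_bump xi.
Proof. by rewrite /quantizer_bump le_max lexx. Qed.

Lemma quantizer_bump_gt0 : 0 < quantizer_bump 0.
Proof.
rewrite /quantizer_bump (nrm0 hn) (powR0 (lt0r_neq0 p0)) subr0 lt_max ltxx/=.
apply: powR_gt0; have [i ->] := dist_min_attained (nrm := nrm) q 0.
by rewrite sub0r (nrmN hn) ffunE (nrm_gt0 hn)//; exact: babs.1.
Qed.

Lemma quantizer_bump_bounded_support : bounded_support quantizer_bump.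
Proof.
have [C C0 nC] := norm_le_nrm hn.
exists (C * r0) => xi xiC; rewrite /quantizer_bump.
have [|i hi] := babs.2 xi.
  by rewrite -(ler_pM2l C0) (le_trans xiC).
apply/max_l; rewrite subr_le0 le_powR ?(ltW p0)// ?dist_min_ge0//.
by rewrite (le_trans _ hi)//; have := dist_min_le q xi i; rewrite ffunE.
Qed.

(** The last vector is repeated, so that this family has as many points as [full_quantizer], where
    the centre takes the spare slot without losing any outer point. Both must have the same size,
    since convergence is assumed for a single [N]. *)
Definition outer_quantizer (a : 'rV[R]_d) (r : R) : {ffun 'I_n.+2 -> 'rV[R]_d} :=
  [ffun i : 'I_n.+2 => a + r *: b (inord (minn i n))].

Definition full_quantizer (a : 'rV[R]_d) (r : R) : {ffun 'I_n.+2 -> 'rV[R]_d} :=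
  [ffun i : 'I_n.+2 => if i == ord_max then a else outer_quantizer a r i].

(** Writing [xi = a + r *: z] multiplies all distances by [r], hence their p-th powers by r^p.
    Adding the centre replaces the outer distance by its minimum with [r * nrm z], and the drop is
    the positive part in [quantizer_bump]. *)
Lemma quantizer_bump_scale a r xi : 0 < r ->
  quantizer_bump (r^-1 *: (xi - a)) = (r `^ p)^-1 *
    (dist_min nrm (outer_quantizer a r) xi `^ p
     - dist_min nrm (full_quantizer a r) xi `^ p).
Proof.
move=> r_gt0.
have nrmZr v : nrm (r *: v) = r * nrm v by rewrite (is_normZ hn) gtr0_norm.
set z := r^-1 *: (xi - a).
have xiE : xi = a + r *: z by rewrite /z scalerA mulfV ?gt_eqF// scale1r subrKC.
have outE i : xi - outer_quantizer a r i = r *: (z - b (inord (minn i n))).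
  by rewrite ffunE {1}xiE opprD addrACA subrr add0r scalerBr.
have fullE : xi - full_quantizer a r ord_max = r *: z.
  by rewrite ffunE eqxx xiE addrC addKr.
have D1 : dist_min nrm (outer_quantizer a r) xi = r * dist_min nrm q z.
  apply/eqP; rewrite eq_le; apply/andP; split.
    have [i ->] := dist_min_attained (nrm := nrm) q z; rewrite ffunE.
    have := dist_min_le (nrm := nrm) (outer_quantizer a r) xi (widen_ord (leqnSn _) i).
    by rewrite outE nrmZr (minn_idPl _) ?inord_val//= -ltnS.
  have [i ->] := dist_min_attained (nrm := nrm) (outer_quantizer a r) xi.
  rewrite outE nrmZr ler_pM2l//.
  by have := dist_min_le (nrm := nrm) q z (inord (minn i n)); rewrite ffunE.
have D2 : dist_min nrm (full_quantizer a r) xi =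
    Num.min (dist_min nrm (outer_quantizer a r) xi) (r * nrm z).
  apply/eqP; rewrite eq_le; apply/andP; split.
    rewrite le_min -nrmZr -fullE dist_min_le andbT D1.
    have [i ->] := dist_min_attained (nrm := nrm) q z; rewrite ffunE.
    have := dist_min_le (nrm := nrm) (full_quantizer a r) xi (widen_ord (leqnSn _) i).
    rewrite ffunE ifN; last by rewrite neq_ltn /= ltn_ord.
    by rewrite outE nrmZr (minn_idPl _) ?inord_val//= -ltnS.
  have [i ->] := dist_min_attained (nrm := nrm) (full_quantizer a r) xi.
  have [->|ni] := eqVneq i ord_max; first by rewrite fullE nrmZr ge_min lexx orbT.
  by rewrite ffunE (negbTE ni) ge_min dist_min_le.
have z0 := nrm_ge0 hn z; have q0 := dist_min_ge0 hn q z.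
have rp0 : 0 < r `^ p by rewrite powR_gt0.
rewrite D2 D1 /quantizer_bump.
have [le|lt] := leP (dist_min nrm q z) (nrm z).
  rewrite max_l; last by rewrite subr_le0 le_powR// ltW.
  by rewrite min_l ?subrr ?mulr0// ler_pM2l.
rewrite max_r; last by rewrite subr_ge0 le_powR// ltW.
rewrite min_r; last by rewrite ler_pM2l// ltW.
by rewrite !powRM ?(ltW r_gt0)// -mulrBr mulKf// gt_eqF.
Qed.

End quantizer_bump.
Arguments quantizer_bump {R d} nrm p {n} b xi.

(** * Couplings given by a density *)

Section density.
Local Open Scope ereal_scope.
Context dd {T : measurableType dd} {R : realType} (m : {measure set T -> \bar R}).
Variable w : T -> R.
Hypotheses (mw : measurable_fun setT w) (w_ge0 : forall x, (0 <= w x)%R).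

(* The proof arguments are unused in the body; they let the measure structure
   below be found by unification. *)
Definition density of measurable_fun setT w & (forall x, (0 <= w x)%R) :
  set T -> \bar R := fun A => \int[m]_(x in A) (w x)%:E.

Let nu := density mw w_ge0.

Let nu0 : nu set0 = 0.
Proof. exact: integral_set0. Qed.

Let nu_ge0 A : 0 <= nu A.
Proof. by apply: integral_ge0 => x _; rewrite lee_fin. Qed.

Let nu_sigma_additive : semi_sigma_additive nu.
Proof.
move=> F mF tF mUF; rewrite /nu /density ge0_integral_bigcup//.
- apply: is_cvg_ereal_nneg_natsum_cond => n _ _.
  by apply: integral_ge0 => x _; rewrite lee_fin.
- exact/measurable_funTS/measurable_EFinP.
- by move=> x _; rewrite lee_fin.
Qed.

HB.instance Definition _ := isMeasure.Build _ _ _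
  (density mw w_ge0) nu0 nu_ge0 nu_sigma_additive.

Import HBNNSimple.

(** Both sides commute with the increasing limit of simple approximations of [f], and for the
    indicator of a measurable set the identity is the definition of [density]. *)
Lemma integral_density (f : T -> \bar R) : measurable_fun setT f ->
  (forall x, 0 <= f x) ->
  \int[density mw w_ge0]_x f x = \int[m]_x (f x * (w x)%:E).
Proof.
move=> mf f0; pose h := nnsfun_approx measurableT mf.
have mw' : measurable_fun setT (fun x => (w x)%:E) by exact/measurable_EFinP.
have w0' x : 0 <= (w x)%:E by rewrite lee_fin.
have hf x : f x = limn (fun n => (h n x)%:E).
  by apply/esym/cvg_lim => //; apply: cvg_nnsfun_approx.
transitivity (limn (fun n => \int[density mw w_ge0]_x (h n x)%:E)).
  rewrite -monotone_convergence//.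
  - exact: eq_integral.
  - by move=> n; exact/measurable_EFinP.
  - by move=> n x _; rewrite lee_fin.
  - by move=> x _ a b ab; rewrite lee_fin; exact/lefP/nd_nnsfun_approx.
transitivity (limn (fun n => \int[m]_x ((h n x)%:E * (w x)%:E))); last first.
  rewrite -monotone_convergence//.
  - apply: eq_integral => x _; apply/cvg_lim => //.
    under eq_fun do rewrite muleC.
    rewrite muleC; apply: cvgeZl => //.
    exact: cvg_nnsfun_approx.
  - by move=> n; apply: emeasurable_funM => //; exact/measurable_EFinP.
  - by move=> n x _; rewrite mule_ge0// lee_fin.
  - move=> x _ a b ab; rewrite lee_wpmul2r// lee_fin.
    exact/lefP/nd_nnsfun_approx.
congr (limn _); apply/funext => n.
transitivity (\int[density mw w_ge0]_x
   (\sum_(y \in range (h n)) (y * \1_(h n @^-1` [set y]) x)%:E)).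
  by apply: eq_integral => t _; rewrite /= fimfunE -fsumEFin.
have mindic r : measurable_fun setT (fun x => (r * \1_(h n @^-1` [set r]) x)%:E).
  by apply/measurable_EFinP; exact: measurable_funM.
rewrite ge0_integral_fsum//; last by move=> y x _; exact: nnfun_muleindic_ge0.
transitivity (\int[m]_x (\sum_(y \in range (h n))
    (y * \1_(h n @^-1` [set y]) x)%:E * (w x)%:E)); last first.
  apply: eq_integral => x _.
  rewrite -ge0_mule_fsuml => [|y]; last exact: nnfun_muleindic_ge0.
  by rewrite fsumEFin // -(fimfunE _ x).
rewrite ge0_integral_fsum//; last 2 first.
  - by move=> y; apply: emeasurable_funM.
  - by move=> y x _; rewrite mule_ge0// nnfun_muleindic_ge0.
apply: eq_fsbigr => r rhn.
under eq_integral do rewrite EFinM.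
rewrite integralZl_indic_nnsfun//.
under [RHS]eq_integral do rewrite EFinM -muleA.
rewrite ge0_integralZl//.
- under [in RHS]eq_integral do rewrite muleC.
  rewrite [in RHS](eq_integral ((fun x => (w x)%:E) \_ (h n @^-1` [set r]))); last first.
    by move=> x _; rewrite epatch_indic.
  by rewrite -integral_mkcond integral_indic// setIT.
- by apply: emeasurable_funM => //; exact/measurable_EFinP.
- by move=> t _; rewrite mule_ge0 ?lee_fin.
- by move: rhn; rewrite inE => -[t _ <-]; rewrite lee_fin.
Qed.

End density.
Arguments integral_density {dd T R m w} mw w_ge0 {f}.

(** * Coupling two measures along a partition of unity *)

Section coupling_weight.
Context {dd} {T : measurableType dd} {R : realType} (mu nu : probability T R).

Lemma EFin_Rintegral (m : {measure set T -> \bar R}) (f : T -> R) :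
  m.-integrable setT (EFin \o f) -> (\int[m]_x (f x)%:E = (\int[m]_x f x)%:E)%E.
Proof. by move=> iF; rewrite /Rintegral fineK//; exact: integrable_fin_num. Qed.

Lemma fubini_tonelli_real (h : T * T -> R) (H : T -> R) :
  measurable_fun setT h -> (forall z, 0 <= h z) ->
  (forall x, nu.-integrable setT (EFin \o (fun y => h (x, y)))) ->
  (forall x, \int[nu]_y h (x, y) = H x) ->
  mu.-integrable setT (EFin \o H) ->
  (\int[mu \x nu]_z (h z)%:E = (\int[mu]_x H x)%:E)%E.
Proof.
move=> mh h0 ih hH iH; rewrite fubini_tonelli1//; last exact/measurable_EFinP.
rewrite -EFin_Rintegral//; apply: eq_integral => x _.
by rewrite /fubini_F EFin_Rintegral ?hH//; exact: ih.
Qed.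

Variables (I : finType) (psi : I -> T -> R) (g : T -> R) (c : T * T -> R).
Variables (eta D K B : R).
Hypotheses (mpsi : forall i, measurable_fun setT (psi i))
  (psi0 : forall i x, 0 <= psi i x)
  (eta0 : 0 < eta) (psi_eta : forall x, \sum_i psi i x <= 1 - eta)
  (g0 : forall x, 0 <= g x)
  (gmu : mu.-integrable setT (EFin \o g)) (gnu : nu.-integrable setT (EFin \o g))
  (mc : measurable_fun setT c) (c0 : forall z, 0 <= c z)
  (D0 : 0 <= D) (K0 : 0 <= K) (B0 : 0 <= B)
  (cD : forall i x y, psi i x != 0 -> psi i y != 0 -> c (x, y) <= D)
  (cK : forall x y, c (x, y) <= K * (g x + g y))
  (gB : forall i x, psi i x != 0 -> g x <= B).

Let al i := \int[mu]_x psi i x.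
Let be i := \int[nu]_x psi i x.
(* 0 when al i = 0 or be i = 0, thanks to 0^-1 = 0 *)
Let t i := Num.min (al i) (be i) / (al i * be i).
(** In [w], piece [i] couples [psi i] of both measures with mass [Num.min (al i) (be i)]. What is
    left of [mu] and of [nu] has densities [rho] and [sigma], both of mass [ms], and is coupled as a
    normalized product. *)
Let rho x := 1 - \sum_i t i * be i * psi i x.
Let sigma y := 1 - \sum_i t i * al i * psi i y.
Let ms := 1 - \sum_i t i * al i * be i.
Let w (z : T * T) :=
  \sum_i t i * (psi i z.1 * psi i z.2) + rho z.1 * sigma z.2 / ms.

Let psi1 i x : psi i x <= 1.
Proof.
have := psi_eta x; rewrite (bigD1 i)//= => h.
have : 0 <= \sum_(j | j != i) psi j x by apply: sumr_ge0 => j _; exact: psi0.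
by move: eta0 h; lra.
Qed.

Let ipsi (m : probability T R) i : m.-integrable setT (EFin \o psi i).
Proof.
apply: (@integrable_dominated _ _ _ _ _ (cst 1)) => //.
  exact: finite_measure_integrable_cst.
by move=> x; rewrite ger0_norm.
Qed.

Let al0 i : 0 <= al i. Proof. exact: Rintegral_ge0. Qed.
Let be0 i : 0 <= be i. Proof. exact: Rintegral_ge0. Qed.

Let talbe i : t i * al i * be i = Num.min (al i) (be i).
Proof.
rewrite /t -mulrA; have [a0|a0] := eqVneq (al i) 0.
  by rewrite a0 !mul0r mulr0 min_l.
have [b0|b0] := eqVneq (be i) 0; first by rewrite b0 !mulr0 min_r.
by rewrite divfK// mulf_neq0.
Qed.

Let t0 i : 0 <= t i.
Proof. by rewrite /t divr_ge0 ?mulr_ge0// le_min al0 be0. Qed.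

Let tbe1 i : t i * be i <= 1.
Proof.
have [a0|a0] := eqVneq (al i) 0; first by rewrite /t a0 mul0r invr0 mulr0 mul0r.
have ap : 0 < al i by rewrite lt_neqAle eq_sym a0 al0.
by rewrite -(ler_pM2r ap) mul1r mulrAC talbe ge_min lexx.
Qed.

Let tal1 i : t i * al i <= 1.
Proof.
have [a0|a0] := eqVneq (be i) 0; first by rewrite /t a0 mulr0 invr0 mulr0 mul0r.
have ap : 0 < be i by rewrite lt_neqAle eq_sym a0 be0.
by rewrite -(ler_pM2r ap) mul1r talbe ge_min lexx orbT.
Qed.

Let tpp i x y : 0 <= t i * (psi i x * psi i y).
Proof. by apply: mulr_ge0 => //; exact: mulr_ge0. Qed.

(** The matched mass is at most the integral of the sum of the [psi i], hence at most [1 - eta]: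
    this is the purpose of the margin [eta]. *)
Let ms_gt0 : 0 < ms.
Proof.
have h : \sum_i t i * al i * be i <= \sum_i al i.
  by apply: ler_sum => i _; rewrite talbe ge_min lexx.
have : \sum_i al i <= 1 - eta.
  rewrite /al -Rintegral_sum; last exact: ipsi.
  rewrite -[leRHS](Rintegral_probability_cst mu); apply: le_Rintegral => //.
    by apply: integrable_EFin_sum => i; exact: ipsi.
  exact: finite_measure_integrable_cst.
by rewrite /ms; move: eta0 h; lra.
Qed.

Let rho_le x : 1 - \sum_i psi i x <= rho x.
Proof.
rewrite lerD2l lerN2; apply: ler_sum => i _.
by rewrite ler_piMl.
Qed.

Let rho0 x : 0 <= rho x.
Proof. by rewrite (le_trans _ (rho_le x))//; have := psi_eta x; move: eta0; lra. Qed.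

Let sigma0 x : 0 <= sigma x.
Proof.
have : \sum_i t i * al i * psi i x <= \sum_i psi i x.
  by apply: ler_sum => i _; rewrite ler_piMl.
by rewrite /sigma; have := psi_eta x; move: eta0; lra.
Qed.

Let w0 z : 0 <= w z.
Proof.
rewrite /w addr_ge0//; last by rewrite divr_ge0 ?(ltW ms_gt0)// mulr_ge0.
by apply: sumr_ge0 => i _; exact: tpp.
Qed.

Let mrho : measurable_fun setT rho.
Proof.
apply: measurable_funB => //; apply: measurable_sum => i.
exact: measurable_funM.
Qed.

Let msigma : measurable_fun setT sigma.
Proof.
apply: measurable_funB => //; apply: measurable_sum => i.
exact: measurable_funM.
Qed.

Let mw : measurable_fun setT w.
Proof.
apply: measurable_funD.
  apply: measurable_sum => i; apply: measurable_funM => //.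
  by apply: measurable_funM; exact: measurableT_comp.
apply: measurable_funM => //; apply: measurable_funM.
  exact: (measurableT_comp mrho).
exact: (measurableT_comp msigma).
Qed.

Let isum (m : probability T R) (a : I -> R) :
  m.-integrable setT (EFin \o (fun x => \sum_i a i * psi i x)).
Proof. by apply: integrable_EFin_sum => i; exact: integrable_EFinZl (ipsi m i). Qed.

Let Esum (m : probability T R) (a : I -> R) :
  \int[m]_x (\sum_i a i * psi i x) = \sum_i a i * \int[m]_x psi i x.
Proof.
rewrite Rintegral_sum => [|i]; last exact: integrable_EFinZl (ipsi m i).
by apply: eq_bigr => i _; rewrite RintegralZl//; exact: ipsi.
Qed.

Let irho (m : probability T R) : m.-integrable setT (EFin \o rho).
Proof.
apply: integrable_EFinB; last exact: isum.
exact: finite_measure_integrable_cst.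
Qed.

Let isigma (m : probability T R) : m.-integrable setT (EFin \o sigma).
Proof.
apply: integrable_EFinB; last exact: isum.
exact: finite_measure_integrable_cst.
Qed.

Let Erho : \int[mu]_x rho x = ms.
Proof.
rewrite RintegralB//; last exact: isum.
  by rewrite Rintegral_probability_cst Esum; congr (_ - _); apply: eq_bigr => i _; rewrite mulrAC.
exact: finite_measure_integrable_cst.
Qed.

Let Esigma : \int[nu]_x sigma x = ms.
Proof.
rewrite RintegralB//; last exact: isum.
  by rewrite Rintegral_probability_cst Esum.
exact: finite_measure_integrable_cst.
Qed.

Let marg1 x : (\int[nu]_y (w (x, y))%:E = 1)%E.
Proof.
pose a i := t i * psi i x.
have wE y : w (x, y) = \sum_i a i * psi i y + rho x / ms * sigma y.
  rewrite /w /=; congr (_ + _); last by rewrite mulrAC.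
  by apply: eq_bigr => i _; rewrite mulrA.
under eq_integral do rewrite wE.
rewrite EFin_Rintegral; last first.
  by apply: integrable_EFinD; [exact: isum|exact: integrable_EFinZl (isigma nu)].
rewrite RintegralD//; [|exact: isum|exact: integrable_EFinZl (isigma nu)].
rewrite Esum RintegralZl//; last exact: isigma.
rewrite Esigma divfK ?gt_eqF//.
congr EFin; rewrite /rho [X in X + _](_ : _ = \sum_i t i * be i * psi i x) ?subrKC//.
by apply: eq_bigr => i _; rewrite mulrAC.
Qed.

Let marg2 y : (\int[mu]_x (w (x, y))%:E = 1)%E.
Proof.
pose a i := t i * psi i y.
have wE x : w (x, y) = \sum_i a i * psi i x + sigma y / ms * rho x.
  rewrite /w /=; congr (_ + _); last by rewrite [RHS]mulrAC [sigma y * _]mulrC.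
  by apply: eq_bigr => i _; rewrite /a; ring.
under eq_integral do rewrite wE.
rewrite EFin_Rintegral; last first.
  by apply: integrable_EFinD; [exact: isum|exact: integrable_EFinZl (irho mu)].
rewrite RintegralD//; [|exact: isum|exact: integrable_EFinZl (irho mu)].
rewrite Esum RintegralZl//; last exact: irho.
rewrite Erho divfK ?gt_eqF//.
congr EFin; rewrite /sigma [X in X + _](_ : _ = \sum_i t i * al i * psi i y) ?subrKC//.
by apply: eq_bigr => i _; rewrite mulrAC.
Qed.

Let igm (m : probability T R) (f : T -> R) : m.-integrable setT (EFin \o g) ->
  measurable_fun setT f -> (forall x, 0 <= f x <= 1) ->
  m.-integrable setT (EFin \o (fun x => g x * f x)).
Proof.
move=> ig mf f1; apply: integrable_dominated (ig) _ => [|x].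
  apply: measurable_funM => //; apply/measurable_EFinP.
  by case/integrableP: ig.
have /andP[f0 f1'] := f1 x.
by rewrite ger0_norm ?mulr_ge0// ler_piMr.
Qed.

Let rho1 x : 0 <= rho x <= 1.
Proof.
rewrite rho0/= gerBl; apply: sumr_ge0 => i _.
by apply: mulr_ge0 => //; exact: mulr_ge0.
Qed.

Let sigma1 x : 0 <= sigma x <= 1.
Proof.
rewrite sigma0/= gerBl; apply: sumr_ge0 => i _.
by apply: mulr_ge0 => //; exact: mulr_ge0.
Qed.

(** The remainder density is [1 - \sum_i psi i] plus the unmatched fractions [(1 - s i) * psi i],
    and [g <= B] wherever some [psi i] is nonzero. It is applied with [s i] equal to [t i * be i]
    and to [t i * al i]. *)
Let residual (m : probability T R) (s : I -> R) :
  m.-integrable setT (EFin \o g) -> (forall i, s i <= 1) ->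
  (forall x, 0 <= 1 - \sum_i s i * psi i x <= 1) ->
  \int[m]_x (g x * (1 - \sum_i s i * psi i x)) <=
  \int[m]_x (g x * (1 - \sum_i psi i x)) +
  B * \sum_i (1 - s i) * \int[m]_x psi i x.
Proof.
move=> ig s1 hs.
have msum (a : I -> R) : measurable_fun setT (fun x => 1 - \sum_i a i * psi i x).
  apply: measurable_funB => //; apply: measurable_sum => i.
  exact: measurable_funM.
have m1 : measurable_fun setT (fun x => 1 - \sum_i psi i x).
  by apply: measurable_funB => //; exact: measurable_sum.
have h1 x : 0 <= 1 - \sum_i psi i x <= 1.
  rewrite gerBl; apply/andP; split; last by apply: sumr_ge0.
  by have := psi_eta x; move: eta0; lra.
have i1 := igm ig m1 h1.
have i2 : m.-integrable setT (EFin \o (fun x => B * \sum_i (1 - s i) * psi i x)).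
  by apply: integrable_EFinZl; exact: isum.
rewrite -Esum -RintegralZl//; last exact: isum.
rewrite -RintegralD//; apply: le_Rintegral => //.
- exact: igm.
- exact: integrable_EFinD.
- move=> x _; rewrite -lerBlDl -mulrBr.
  have -> : 1 - \sum_i s i * psi i x - (1 - \sum_i psi i x) =
      \sum_i (1 - s i) * psi i x.
    under [RHS]eq_bigr do rewrite mulrBl mul1r.
    by rewrite sumrB; ring.
  rewrite !mulr_sumr ler_sum// => i _.
  have [->|/gB gBx] := eqVneq (psi i x) 0; first by rewrite !mulr0.
  by rewrite ler_wpM2r// mulr_ge0// subr_ge0.
Qed.

(** The cost has three sources: displacement inside a piece, at most [D]; mass not covered by the
    partition, weighted by [g]; and the mismatch of the masses of the pieces, where [g] is at most
    [B]. *)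
Lemma coupling_weight : exists w : T * T -> R, [/\ measurable_fun setT w,
  (forall z, 0 <= w z), (forall x, (\int[nu]_y (w (x, y))%:E = 1)%E),
  (forall y, (\int[mu]_x (w (x, y))%:E = 1)%E) &
  (\int[mu \x nu]_z ((c z)%:E * (w z)%:E) <=
   (D + K * (\int[mu]_x (g x * (1 - \sum_i psi i x)) +
             \int[nu]_x (g x * (1 - \sum_i psi i x)) +
             B * \sum_i `|\int[nu]_x psi i x - \int[mu]_x psi i x|))%:E)%E].
Proof.
exists w; split => //.
(* The majorant bounds [c] by [D] on the matched part and by [K * (g x + g y)] on the product part;
   being a sum of products, it is integrated explicitly by Tonelli. *)
pose h (z : T * T) := D * (\sum_i t i * (psi i z.1 * psi i z.2)) +
  K / ms * ((g z.1 + g z.2) * (rho z.1 * sigma z.2)).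
have mg : measurable_fun setT g by apply/measurable_EFinP; case/integrableP: gmu.
have mh : measurable_fun setT h.
  apply: measurable_funD; apply: measurable_funM => //.
    apply: measurable_sum => i; apply: measurable_funM => //.
    by apply: measurable_funM; exact: measurableT_comp.
  apply: measurable_funM.
    by apply: measurable_funD; exact: measurableT_comp.
  by apply: measurable_funM; [exact: (measurableT_comp mrho)|
    exact: (measurableT_comp msigma)].
have h0 z : 0 <= h z.
  rewrite /h addr_ge0// mulr_ge0//.
  - by apply: sumr_ge0 => i _; exact: tpp.
  - by rewrite divr_ge0// ltW.
  - by rewrite mulr_ge0// ?addr_ge0// mulr_ge0.
have cw_h z : c z * w z <= h z.
  case: z => x y; rewrite /w /h /= mulrDr lerD//.
    rewrite !mulr_sumr ler_sum// => i _.
    have [->|px] := eqVneq (psi i x) 0; first by rewrite !mul0r !mulr0.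
    have [->|py] := eqVneq (psi i y) 0; first by rewrite !mulr0.
    by rewrite (ler_wpM2r (tpp _ _ _)) ?(cD px py).
  rewrite [leRHS](_ : _ = K * (g x + g y) * (rho x * sigma y / ms)); last by ring.
  by rewrite ler_wpM2r// divr_ge0 ?(ltW ms_gt0)// mulr_ge0.
pose Bs := \int[nu]_y (g y * sigma y).
pose As := \int[mu]_x (g x * rho x).
pose H x := \sum_i (D * t i * be i) * psi i x +
  (K * (g x * rho x) + K / ms * Bs * rho x).
have igs : nu.-integrable setT (EFin \o (fun y => g y * sigma y)) by exact: igm.
have igr : mu.-integrable setT (EFin \o (fun y => g y * rho y)) by exact: igm.
have hE x y : h (x, y) = \sum_i (D * t i * psi i x) * psi i y +
    (K / ms * g x * rho x * sigma y + K / ms * rho x * (g y * sigma y)).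
  rewrite /h /=; congr (_ + _); last by ring.
  by rewrite mulr_sumr; apply: eq_bigr => i _; ring.
have inner x : nu.-integrable setT (EFin \o (fun y =>
    K / ms * g x * rho x * sigma y + K / ms * rho x * (g y * sigma y))).
  apply: integrable_EFinD; first exact: integrable_EFinZl (isigma nu).
  exact: integrable_EFinZl igs.
have outer : mu.-integrable setT (EFin \o (fun x =>
    K * (g x * rho x) + K / ms * Bs * rho x)).
  apply: integrable_EFinD; first exact: integrable_EFinZl igr.
  exact: integrable_EFinZl (irho mu).
have ihx x : nu.-integrable setT (EFin \o (fun y => h (x, y))).
  under eq_fun do rewrite hE.
  apply: integrable_EFinD; first exact: isum.
  exact: inner.
have hH x : \int[nu]_y h (x, y) = H x.
  under eq_Rintegral do rewrite hE.
  rewrite (RintegralD measurableT (isum nu _) (inner x)).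
  rewrite (RintegralD measurableT (integrable_EFinZl _ (isigma nu)) (integrable_EFinZl _ igs)).
  rewrite Esum (RintegralZl _ measurableT (isigma nu)) (RintegralZl _ measurableT igs).
  rewrite Esigma -/Bs /H; congr (_ + _).
    by apply: eq_bigr => i _; rewrite /be; ring.
  by field; rewrite gt_eqF.
have iH : mu.-integrable setT (EFin \o H).
  apply: integrable_EFinD; first exact: isum.
  exact: outer.
apply: (@le_trans _ _ (\int[mu \x nu]_z (h z)%:E)%E).
  apply: ge0_le_integral => //.
  - by move=> z _; rewrite -EFinM lee_fin mulr_ge0.
  - by apply/measurable_EFinP; exact: measurable_funM.
  - exact/measurable_EFinP.
  - by move=> z _; rewrite -EFinM lee_fin.
rewrite (fubini_tonelli_real mh h0 ihx hH iH) lee_fin.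
rewrite /H (RintegralD measurableT (isum mu _) outer).
rewrite (RintegralD measurableT (integrable_EFinZl _ igr) (integrable_EFinZl _ (irho mu))).
rewrite Esum (RintegralZl _ measurableT igr) (RintegralZl _ measurableT (irho mu)).
rewrite Erho -/As lerD//.
  rewrite (eq_bigr (fun i => D * (t i * al i * be i))); last by move=> i _; rewrite /al; ring.
  rewrite -mulr_sumr ler_piMr//.
  by move: ms_gt0; rewrite /ms; lra.
have -> : K / ms * Bs * ms = K * Bs by field; rewrite gt_eqF.
rewrite -mulrDr ler_wpM2l//.
have rA := residual gmu tbe1 rho1; have rB := residual gnu tal1 sigma1.
rewrite (le_trans (lerD rA rB))// addrACA lerD2l -mulrDr ler_wpM2l//.
rewrite -big_split/= ler_sum// => i _.
(* What each measure has in excess of the minimum adds up to the absolute difference of [al i] and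
   [be i]. *)
rewrite -/(al i) -/(be i) !mulrBl !mul1r talbe mulrAC talbe.
by case: (leP (al i) (be i)) => ab; have := ler_norm (be i - al i);
   have := ler_norm (- (be i - al i)); rewrite normrN; lra.
Qed.

End coupling_weight.

Section couplings.
Context {R : realType} {d : nat}.
Variables mu nu : probability (borelRd R d) R.

(** Tonelli turns the two normalizations of [w] into total mass 1 and the marginals [mu] and [nu].
    The integral formula is part of the conclusion because it is the only access to the cost of the
    existential [pi]. *)
Lemma coupling_of_weight (w : borelRd R d * borelRd R d -> R) :
  measurable_fun setT w -> (forall z, 0 <= w z) ->
  (forall x, (\int[nu]_y (w (x, y))%:E = 1)%E) ->
  (forall y, (\int[mu]_x (w (x, y))%:E = 1)%E) ->
  exists2 pi : probability (borelRd R d * borelRd R d)%type R, coupling mu nu pi &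
    forall f : borelRd R d * borelRd R d -> \bar R, measurable_fun setT f ->
      (forall z, (0 <= f z)%E) ->
      (\int[pi]_z f z = \int[mu \x nu]_z (f z * (w z)%:E))%E.
Proof.
move=> mw w0 w1 w2.
have mw' : measurable_fun setT (fun z => (w z)%:E) by exact/measurable_EFinP.
pose dens := density (mu \x nu)%E mw w0.
have densT : dens setT = 1%E.
  rewrite /dens /density fubini_tonelli1//.
  transitivity (\int[mu]_x (cst 1%E) x)%E.
    by apply: eq_integral => x _; rewrite /fubini_F w1.
  by rewrite integral_cst// mul1e; exact: (@probability_setT _ _ _ mu).
pose mix := @Measure_isProbability.Build _ _ R dens densT.
pose pi : probability _ _ := HB.pack dens mix.
exists pi; last by move=> f mf f0; exact: (integral_density mw w0 mf f0).
have piE A : measurable A -> pi A = (\int[mu \x nu]_z ((\1_A z)%:E * (w z)%:E))%E.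
  move=> mA; rewrite -(integral_density mw w0) ?integral_indic ?setIT//.
  - by apply/measurable_EFinP; exact: measurable_indic.
move=> A mA; rewrite /pushforward; split.
{ have mfA : measurable (fst @^-1` A : set (borelRd R d * borelRd R d)).
    by rewrite -[X in measurable X]setTI; exact: measurable_fst.
  rewrite piE// fubini_tonelli1//; first last.
  - by move=> z; rewrite mule_ge0// lee_fin.
  - by apply: emeasurable_funM => //; apply/measurable_EFinP; exact: measurable_indic.
  transitivity (\int[mu]_x (\1_A x)%:E)%E; last by rewrite integral_indic// setIT.
  apply: eq_integral => x _; rewrite /fubini_F.
  under eq_integral do rewrite (_ : \1_(fst @^-1` A) _ = \1_A x)//.
  rewrite ge0_integralZl//; first by rewrite w1 mule1.
  - exact: (measurableT_comp mw' (pair1_measurable x)).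
  - by move=> y _; rewrite lee_fin. }
{ have mfA : measurable (snd @^-1` A : set (borelRd R d * borelRd R d)).
    by rewrite -[X in measurable X]setTI; exact: measurable_snd.
  rewrite piE// fubini_tonelli2//; first last.
  - by move=> z; rewrite mule_ge0// lee_fin.
  - by apply: emeasurable_funM => //; apply/measurable_EFinP; exact: measurable_indic.
  transitivity (\int[nu]_x (\1_A x)%:E)%E; last by rewrite integral_indic// setIT.
  apply: eq_integral => y _; rewrite /fubini_G.
  under eq_integral do rewrite (_ : \1_(snd @^-1` A) _ = \1_A y)//.
  rewrite ge0_integralZl//; first by rewrite w2 mule1.
  - exact: (measurableT_comp mw' (pair2_measurable y)).
  - by move=> x _; rewrite lee_fin. }
Qed.

End couplings.

(** * Measurability of the distance on the product space *)

Section measurable_dist.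
Context {R : realType} {d : nat} {nrm : 'rV[R]_d -> R}.
Hypothesis hn : is_norm nrm.

Lemma rat_approx (x : 'rV[R]_d) (e : R) : 0 < e ->
  exists q : 'rV[rat]_d, nrm (x - map_mx ratr q) < e.
Proof.
move=> e0; have [C C0 nC] := nrm_le_norm hn.
have eC : 0 < e / C / 2 by rewrite !divr_gt0.
have H i : exists q : rat, `|x ord0 i - ratr q| <= e / C / 2.
  have [q] := @rat_in_itvoo R (x ord0 i - e / C / 2) (x ord0 i + e / C / 2) ltac:(lra).
  rewrite in_itv/= => /andP[q1 q2]; exists q.
  by rewrite ler_norml; apply/andP; split; lra.
have [q hq] := choice H.
exists (\row_i q i); rewrite (le_lt_trans (nC _))// -ltr_pdivlMl// mulrC.
apply: (@le_lt_trans _ _ (e / C / 2)).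
  by apply: norm_le_coord => [|i]; rewrite ?(ltW eC)// !mxE.
by rewrite ltr_pdivrMr// ltr_pMr ?divr_gt0// ltr1n.
Qed.

(* The difference is not obviously measurable for the product sigma-algebra, but
   nrm (x - y) is the infimum of nrm (x - q) + nrm (y - q) over rational q. *)
Lemma measurable_nrm_dist : measurable_fun setT
  (fun z : borelRd R d * borelRd R d => nrm ((z.1 : 'rV[R]_d) - z.2)).
Proof.
apply: (measurability _ (RGenInftyO.measurableE R)) => _ [_ [t ->] <-].
rewrite setTI.
have -> : (fun z : borelRd R d * borelRd R d => nrm ((z.1 : 'rV[R]_d) - z.2)) @^-1`
    `]-oo, t[%classic =
  \bigcup_(q : 'rV[rat]_d) [set z : borelRd R d * borelRd R d |
    nrm ((z.1 : 'rV[R]_d) - map_mx ratr q) +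
    nrm ((z.2 : 'rV[R]_d) - map_mx ratr q) < t].
  apply/seteqP; split => -[x y] /=; rewrite in_itv/=.
    move=> xyt; have [q hq] := @rat_approx x ((t - nrm (x - y)) / 2) ltac:(lra).
    exists q => //=.
    have := nrm_triangleB hn y x (map_mx ratr q).
    by rewrite (nrmB hn y x); lra.
  move=> [q _ /=]; apply: le_lt_trans.
  by rewrite -[nrm (y - _)](nrmB hn) (nrm_triangleB hn).
apply: countable_bigcupT_measurable; first exact: countableP.
move=> q; rewrite -[X in measurable X]setTI.
pose F (z : borelRd R d * borelRd R d) := nrm ((z.1 : 'rV[R]_d) - map_mx ratr q) +
    nrm ((z.2 : 'rV[R]_d) - map_mx ratr q).
have mF : measurable_fun setT F.
  have mq : measurable_fun setT (fun x : borelRd R d => nrm ((x : 'rV[R]_d) - map_mx ratr q)).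
    exact: (continuous_borel (@nrmB_continuous R d nrm hn (map_mx ratr q))).
  by apply: measurable_funD; [exact: (measurableT_comp mq measurable_fst)|exact: (measurableT_comp mq measurable_snd)].
have -> : [set z | F z < t] = F @^-1` `]-oo, t[%classic.
  by apply/seteqP; split => z /=; rewrite in_itv.
exact: mF.
Qed.

End measurable_dist.

(** * Convergence in Wasserstein distance *)

Section partition.
Context {R : realType} {d : nat} {nrm : 'rV[R]_d -> R}.
Hypothesis hn : is_norm nrm.
Variable p : R.
Hypothesis hp : 1 <= p.
Let p0 : 0 < p := lt_le_trans ltr01 hp.

Lemma partition_of_unity (nu : probability (borelRd R d) R) (delta e : R) :
  finite_moment nrm p nu -> 0 < delta -> 0 < e ->
  exists (I : finType) (psi : I -> 'rV[R]_d -> R) (eta : R),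
    [/\ (forall i, continuous (psi i)) /\ (forall i, bounded_support (psi i)),
        forall i x, 0 <= psi i x,
        0 < eta /\ forall x, \sum_i psi i x <= 1 - eta,
        forall i x y, psi i x != 0 -> psi i y != 0 -> nrm (x - y) <= delta &
        \int[nu]_x (nrm x `^ p * (1 - \sum_i psi i x)) <= e].
Proof.
move=> fnu delta0 e0; have [C C0 nC] := nrm_le_norm hn.
(* A tent has sup-norm radius [2 * h], so two points of its support are less than [4 * h] apart,
   that is, at most [delta] for [nrm]. *)
pose h := delta / (4 * C).
have h0 : 0 < h by rewrite divr_gt0// mulr_gt0.
pose tent (x : 'rV[R]_d) := Num.max 0 (1 - `|x| / (2 * h)).
have ctent a : continuous (fun x : 'rV[R]_d => tent (x - a)).
  move=> x; apply: (@continuous_comp _ _ _ (fun x : 'rV[R]_d => x - a) tent).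
    by apply: (@continuousB R); [exact: cvg_id|exact: cst_continuous].
  apply: continuous_max; first exact: cst_continuous.
  apply: (@continuousB R); first exact: cst_continuous.
  by apply: continuousM; [exact: norm_continuous|exact: cst_continuous].
have tent0 x : 0 <= tent x by rewrite /tent le_max lexx.
have tent_supp x : tent x != 0 -> `|x| < 2 * h.
  apply: contraNT; rewrite -leNgt => hx; rewrite /tent; apply/eqP/max_l.
  by rewrite subr_le0 ler_pdivlMr ?mul1r// mulr_gt0.
pose I n := {ffun 'I_d -> 'I_(n + n).+1}.
pose a n (i : I n) := lattice_point n h i.
pose Psi n (x : 'rV[R]_d) : R := \sum_i tent (x - a n i).
(* Flooring the denominator at 1/2 keeps the quotient continuous outside the lattice cube; inside it
   some tent is at least 1/2, so the quotients add up to exactly 1. *)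
pose dn n (x : 'rV[R]_d) : R := Num.max 2^-1 (Psi n x).
have dn0 n x : 0 < dn n x by rewrite /dn lt_max invr_gt0 ltr0n.
(* The prefactor creates the margin [eta = n.+2%:R^-1]; with [n.+2] it is positive already at
   [n = 0]. *)
pose psi n (i : I n) (x : 'rV[R]_d) : R := (1 - n.+2%:R^-1) * (tent (x - a n i) / dn n x).
have n2 n : 0 < 1 - n.+2%:R^-1 :> R.
  by rewrite subr_gt0 invf_lt1// ltr1n.
have cpsi n i : continuous (psi n i).
  have cdn : continuous (dn n).
    apply: (continuous_maxr (@continuous_cst R 'rV[R]_d _)).
    by apply: continuous_sumr => j; exact: ctent.
  apply: (continuous_mulr (@continuous_cst R 'rV[R]_d _)).
  apply: (@continuous_mulr R 'rV[R]_d); first exact: ctent.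
  by move=> x; apply: continuousV; [rewrite gt_eqF|exact: cdn].
have psi0 n i x : 0 <= psi n i x.
  by rewrite mulr_ge0 ?(ltW (n2 n))// divr_ge0// ltW.
have psi_tent n i x : psi n i x != 0 -> tent (x - a n i) != 0.
  by apply: contra => /eqP t0; rewrite /psi t0 mul0r mulr0.
have sum_psi n x : \sum_i psi n i x = (1 - n.+2%:R^-1) * (Psi n x / dn n x).
  by rewrite -mulr_sumr -mulr_suml.
have Psi0 n x : 0 <= Psi n x by apply: sumr_ge0.
have Psi_dn n x : 0 <= Psi n x / dn n x <= 1.
  by rewrite divr_ge0 ?(ltW (dn0 _ _))//= ler_pdivrMr// mul1r /dn le_max lexx orbT.
have bpsi n i : bounded_support (psi n i).
  exists (2 * h + `|a n i|) => x hx; apply/eqP; apply: contraT => /psi_tent/tent_supp.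
  by have := lerB_dist x (a n i); move: hx; lra.
have g0 x : 0 <= nrm x `^ p by exact: powR_ge0.
pose f n (x : 'rV[R]_d) : R := nrm x `^ p * (1 - \sum_i psi n i x).
have sum01 n x : 0 <= 1 - \sum_i psi n i x <= 1.
  have /andP[q0 q1] := Psi_dn n x.
  rewrite sum_psi gerBl subr_ge0 mulr_ge0 ?(ltW (n2 n))// andbT.
  by rewrite mulr_ile1 ?(ltW (n2 n))// gerBl invr_ge0.
have cf n : continuous (f n).
  apply: (continuous_mulr (nrm_powR_continuous hn hp)).
  apply: (continuous_subr (@continuous_cst R 'rV[R]_d _)).
  by apply: continuous_sumr => j; exact: cpsi.
have ig := finite_moment_integrable hn hp fnu.
have fg n x : `|f n x| <= nrm x `^ p.
  by have /andP[s0 s1] := sum01 n x; rewrite ger0_norm ?mulr_ge0// ler_piMr.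
have f_cvg x : (f ^~ x) @ \oo --> (0 : R).
  (* From [n0] on, [x] lies in the lattice cube and the uncovered part at [x] is only the margin. *)
  pose n0 := `|Num.ceil (`|x| / h)|%N.
  have n0P n : (n0 <= n)%N -> f n x = nrm x `^ p * n.+2%:R^-1.
    move=> n0n; have xn : `|x| <= h * n%:R.
      rewrite mulrC -ler_pdivrMr// (le_trans (ceil_ge _))//.
      rewrite (@le_trans _ _ n0%:R) ?ler_nat// /n0 natr_absz ler_int.
      by rewrite ler_norm.
    have [i hi] := lattice_dense h0 xn.
    have half : 2^-1 <= Psi n x.
      rewrite /Psi (bigD1 i)//= ler_wpDr ?sumr_ge0// /tent le_max; apply/orP; right.
      have : `|x - a n i| / (2 * h) <= 2^-1.
        have h2 : 0 < 2 * h by rewrite mulr_gt0.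
        have e1 : 2^-1 * (2 * h) = h by field.
        by rewrite (ler_pdivrMr _ _ h2) e1.
      by lra.
    by rewrite /f sum_psi /dn max_r// divff ?gt_eqF ?(lt_le_trans _ half)// mulr1 opprB addrC subrK.
  have : (fun n => nrm x `^ p * n.+2%:R^-1) @ \oo --> nrm x `^ p * 0.
    apply: cvgMl_tmp.
    by have := @cvg_harmonic R; rewrite -cvg_shiftS.
  rewrite mulr0; apply: cvg_trans; apply: near_eq_cvg.
  by exists n0 => // n /= /n0P.
have : (fun n => \int[nu]_x f n x) @ \oo --> (0 : R).
  exact: (Rintegral_dominated_cvg0 (fun n => continuous_borel (cf n)) ig fg f_cvg).
move=> /cvgrPdist_le/(_ _ e0)/filter_ex[n].
rewrite sub0r normrN => hne.
exists (I n), (psi n), (n.+2%:R^-1); split => //.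
- split; first by rewrite invr_gt0.
  move=> x; rewrite sum_psi ler_piMr ?(ltW (n2 n))//.
  by case/andP: (Psi_dn n x).
- move=> i x y /psi_tent/tent_supp hx /psi_tent/tent_supp hy.
  rewrite (le_trans (nC _))// mulrC -ler_pdivlMr//.
  have -> : x - y = (x - a n i) - (y - a n i) by rewrite opprB addrA subrK.
  rewrite (le_trans (ler_normB _ _))//.
  have -> : delta / C = 2 * h + 2 * h by rewrite /h; field; rewrite gt_eqF.
  by rewrite lerD// ltW.
- by rewrite (le_trans (ler_norm _)).
Qed.

Variables (mu : nat -> probability (borelRd R d) R) (nu : probability (borelRd R d) R).
Hypothesis (fmu : forall n, (1 <= n)%N -> finite_moment nrm p (mu n))
  (fnu : finite_moment nrm p nu).
Hypothesis cvgC : forall f, continuous f -> bounded_support f ->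
  (fun n => \int[mu n]_x f x) @ \oo --> \int[nu]_x f x.
Hypothesis cvgM : (fun n => \int[mu n]_x (nrm x `^ p)) @ \oo --> \int[nu]_x (nrm x `^ p).

Lemma coupling_cost_near (E : R) : 0 < E ->
  \forall n \near \oo, exists2 pi, coupling (mu n) nu pi &
    (\int[pi]_z ((nrm ((z.1 : 'rV[R]_d) - z.2) `^ p)%:E) <= E%:E)%E.
Proof.
move=> E0.
pose K : R := 2 `^ p.
have K0 : 0 < K by rewrite powR_gt0.
(* Budget: [E / 4] for displacement inside the pieces and, in the limit, [E / 8] for each of the two
   uncovered parts after multiplication by [K]. The total [E / 2] is strictly below [E], hence
   reached for large [n]. *)
pose delta := (E / 4) `^ p^-1.
have delta0 : 0 < delta by rewrite powR_gt0// divr_gt0.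
have e0 : 0 < E / (8 * K) by rewrite divr_gt0// mulr_gt0.
have [I [psi [eta [[cpsi bpsi] psi0 [eta0 psi_eta] diam small]]]] :=
  partition_of_unity fnu delta0 e0.
have cS : continuous (fun x => \sum_i psi i x) by exact: continuous_sumr.
have bS : bounded_support (fun x => \sum_i psi i x) by exact: bounded_support_sum.
have [C C0 nC] := nrm_le_norm hn.
have [T hT] := bS.
pose B := (C * Num.max 0 T) `^ p.
have psi_supp i x : psi i x != 0 -> nrm x `^ p <= B.
  move=> nz; rewrite /B; apply: le_powR; rewrite ?(ltW p0) ?nrm_ge0//.
  rewrite (le_trans (nC _))// ler_pM2l// le_max; apply/orP; right.
  rewrite leNgt; apply: contra nz => /ltW/hT/eqP.
  by rewrite psumr_eq0// => /allP/(_ i); rewrite mem_index_enum => /(_ isT).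
pose g (x : 'rV[R]_d) : R := nrm x `^ p.
pose S (x : 'rV[R]_d) : R := \sum_i psi i x.
pose bound n := E / 4 + K * (\int[mu n]_x (g x * (1 - S x)) +
   \int[nu]_x (g x * (1 - S x)) +
   B * \sum_i `|\int[nu]_x psi i x - \int[mu n]_x psi i x|).
have cgS : continuous (fun x => g x * S x).
  exact: (continuous_mulr (nrm_powR_continuous hn hp) cS).
have bgS : bounded_support (fun x => g x * S x) by exact: bounded_supportMl.
have Eres (m : probability (borelRd R d) R) : finite_moment nrm p m ->
    \int[m]_x (g x * (1 - S x)) = \int[m]_x g x - \int[m]_x (g x * S x).
  move=> fm; rewrite -RintegralB//.
  - by apply: eq_Rintegral => x _; rewrite mulrBr mulr1.
  - exact: finite_moment_integrable.
  - exact: continuous_bounded_support_integrable.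
(* The function [g * (1 - S)] is unbounded in general, but it is [g] minus a test function of
   bounded support; convergence of the moments enters here. *)
have cvg_res : (fun n => \int[mu n]_x (g x * (1 - S x))) @ \oo -->
    \int[nu]_x (g x * (1 - S x)).
  rewrite Eres//.
  have : (fun n => \int[mu n]_x g x - \int[mu n]_x (g x * S x)) @ \oo -->
      \int[nu]_x g x - \int[nu]_x (g x * S x).
    by apply: cvgB; [exact: cvgM|exact: cvgC].
  apply: cvg_trans; apply: near_eq_cvg; exists 1 => //= n n1.
  by rewrite Eres//; exact: fmu.
have cvg_bound : bound @ \oo --> E / 4 + K * (\int[nu]_x (g x * (1 - S x)) +
   \int[nu]_x (g x * (1 - S x)) + B * \sum_(i : I) 0).
  apply: cvgD; first exact: cvg_cst.
  apply: cvgMl_tmp; apply: cvgD.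
    by apply: cvgD; [exact: cvg_res|exact: cvg_cst].
  apply: cvgMl_tmp; apply: cvg_sumr => i.
  rewrite -(@normr0 R R); apply: cvg_norm.
  rewrite -[X in _ --> X](subrr (\int[nu]_x psi i x)).
  by apply: cvgB; [exact: cvg_cst|exact: cvgC].
have limE : E / 4 + K * (\int[nu]_x (g x * (1 - S x)) +
   \int[nu]_x (g x * (1 - S x)) + B * \sum_(i : I) 0) < E.
  have h : K * \int[nu]_x (g x * (1 - S x)) <= E / 8.
    have -> : E / 8 = K * (E / (8 * K)) by field; rewrite gt_eqF.
    by rewrite ler_pM2l.
  by rewrite big1// mulr0 addr0 mulrDr; lra.
have nb : \forall n \near \oo, bound n < E.
  exact: (@cvgr_lt R nat \oo _ bound _ cvg_bound E limE).
near=> n.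
have n1 : (1 <= n)%N by near: n; exists 1.
have mdist := measurable_nrm_dist hn.
pose c (z : borelRd R d * borelRd R d) := nrm ((z.1 : 'rV[R]_d) - z.2) `^ p.
have mc : measurable_fun setT c by exact: (measurableT_comp (measurable_powR p) mdist).
have c_ge0 z : 0 <= c z by exact: powR_ge0.
have g_ge0 x : 0 <= g x by exact: powR_ge0.
have cD i x y : psi i x != 0 -> psi i y != 0 -> c (x, y) <= E / 4.
  move=> px py; rewrite -[E / 4](powRVK p0) ?divr_ge0 ?(ltW E0)//.
  by apply: le_powR; rewrite ?(ltW p0) ?nrm_ge0//; exact: diam px py.
have cK x y : c (x, y) <= K * (g x + g y).
  apply: le_trans (powRD_le (ltW p0) (nrm_ge0 hn x) (nrm_ge0 hn y)).
  apply: le_powR; rewrite ?(ltW p0) ?nrm_ge0//=.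
  by rewrite -[nrm y](nrmN hn) (is_norm_triangle hn).
have E40 : 0 <= E / 4 by rewrite divr_ge0// ltW.
have B0 : 0 <= B by exact: powR_ge0.
have [w [mw w0 w1 w2 cw]] := coupling_weight
  (fun i => continuous_borel (cpsi i)) psi0 eta0 psi_eta g_ge0
  (finite_moment_integrable hn hp (fmu n1)) (finite_moment_integrable hn hp fnu)
  mc c_ge0 E40 (ltW K0) B0 cD cK psi_supp.
have [pi cpl Epi] := coupling_of_weight mw w0 w1 w2.
exists pi => //; rewrite (Epi (EFin \o c))//.
- rewrite (le_trans cw)// lee_fin; apply: ltW.
  by near: n.
- exact/measurable_EFinP.
Unshelve. all: by end_near. Qed.

Lemma cvg_wasserstein :
  (fun n => wasserstein nrm p (mu n) nu) @ \oo --> 0%E.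
Proof.
have W0 n : (0 <= wasserstein nrm p (mu n) nu)%E by exact: poweR_ge0.
have near_le e : 0 < e ->
    \forall n \near \oo, (wasserstein nrm p (mu n) nu <= e%:E)%E.
  move=> e0; have : 0 < e `^ p by rewrite powR_gt0.
  move/coupling_cost_near; apply: filterS => n [pi cpl cost].
  rewrite -[e](powRK p0 (ltW e0)) -poweR_EFin /wasserstein.
  apply: gt0_ler_poweR.
  - by rewrite invr_ge0 ltW.
  - rewrite in_itv/= leey andbT; apply: le_ereal_inf_tmp => _ [pi' _ <-].
    by apply: integral_ge0 => z _; rewrite lee_fin powR_ge0.
  - by rewrite in_itv/= leey andbT lee_fin powR_ge0.
  - apply: le_trans cost; apply: ereal_inf_lbound; exists pi => //.
have fin e : (wasserstein nrm p (mu e) nu <= 1%:E)%E ->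
    wasserstein nrm p (mu e) nu \is a fin_num.
  by move=> h; rewrite ge0_fin_numE// (le_lt_trans h)// ltry.
apply/fine_cvgP; split.
  (* The distance is extended-real; any one bound shows it is eventually finite. *)
  by apply: filterS (near_le 1 ltr01) => n; exact: fin.
apply/cvgrPdist_le => e e0; near=> n.
rewrite sub0r normrN ger0_norm ?fine_ge0//=.
rewrite -lee_fin fineK; first by near: n; exact: near_le.
by apply: fin; near: n; exact: near_le.
Unshelve. all: by end_near. Qed.

End partition.

(** * Quantization errors are Lipschitz for the Wasserstein distance *)

Section quantizer_lipschitz.
Context {R : realType} {d : nat} {nrm : 'rV[R]_d -> R}.
Hypothesis hn : is_norm nrm.
Variable p : R.
Hypothesis hp : 1 <= p.
Let p0 : 0 < p := lt_le_trans ltr01 hp.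
Variables mu nu : probability (borelRd R d) R.

Lemma integral_coupling_fst pi (f : borelRd R d -> \bar R) : coupling mu nu pi ->
  measurable_fun setT f -> (forall x, (0 <= f x)%E) ->
  (\int[pi]_z f z.1 = \int[mu]_x f x)%E.
Proof.
move=> cpl mf f0; rewrite [RHS](eq_measure_integral (pushforward pi fst)); last first.
  by move=> A mA _; have [E _] := cpl A mA; exact: esym E.
by rewrite ge0_integral_pushforward//.
Qed.

Lemma integral_coupling_snd pi (f : borelRd R d -> \bar R) : coupling mu nu pi ->
  measurable_fun setT f -> (forall x, (0 <= f x)%E) ->
  (\int[pi]_z f z.2 = \int[nu]_x f x)%E.
Proof.
move=> cpl mf f0; rewrite [RHS](eq_measure_integral (pushforward pi snd)); last first.
  by move=> A mA _; have [_ E] := cpl A mA; exact: esym E.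
by rewrite ge0_integral_pushforward//.
Qed.

Let Lnorm_fin (pi : probability (borelRd R d * borelRd R d)%type R)
    (f : borelRd R d * borelRd R d -> R) : (forall z, 0 <= f z) ->
  ('N[pi]_p%:E[EFin \o f] = (\int[pi]_z (f z `^ p)%:E) `^ p^-1)%E.
Proof.
move=> f0; rewrite unlock /Lnorm; congr (_ `^ _)%E.
by apply: eq_integral => z _ /=; rewrite ger0_norm.
Qed.

(** By the marginal conditions both errors are L^p norms under [pi] of [dist_min nrm x], read on
    either coordinate. This function is 1-Lipschitz whatever [x] is, so the bound is uniform in the
    quantizer. *)
Lemma quant_error_coupling pi n (x : {ffun 'I_n.+1 -> 'rV[R]_d}) (e : R) :
  finite_moment nrm p mu -> finite_moment nrm p nu -> coupling mu nu pi -> 0 <= e ->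
  (\int[pi]_z ((nrm ((z.1 : 'rV[R]_d) - z.2) `^ p)%:E) <= (e `^ p)%:E)%E ->
  `|quant_error nrm p mu x - quant_error nrm p nu x| <= e.
Proof.
move=> fmu fnu cpl e0 cost.
have mdm := continuous_borel (@dist_min_continuous _ _ _ hn _ x).
have mdmp := continuous_borel (@dist_min_powR_continuous _ _ _ hn _ hp _ x).
have dm0 := dist_min_ge0 hn x.
pose F (z : borelRd R d * borelRd R d) := dist_min nrm x z.1.
pose G (z : borelRd R d * borelRd R d) := dist_min nrm x z.2.
pose D (z : borelRd R d * borelRd R d) := nrm ((z.1 : 'rV[R]_d) - z.2).
have mF : measurable_fun setT F by exact: (measurableT_comp mdm measurable_fst).
have mG : measurable_fun setT G by exact: (measurableT_comp mdm measurable_snd).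
have mD : measurable_fun setT D by exact: measurable_nrm_dist.
have D0 z : 0 <= D z by exact: nrm_ge0.
have NF : ('N[pi]_p%:E[EFin \o F] = (quant_error nrm p mu x)%:E)%E.
  rewrite Lnorm_fin//; last by move=> z; exact: dm0.
  rewrite (@integral_coupling_fst pi (fun y => (dist_min nrm x y `^ p)%:E))//.
  - rewrite EFin_Rintegral; last exact: dist_min_integrable.
    by rewrite poweR_EFin quant_errorE.
  - exact/measurable_EFinP.
  - by move=> y; rewrite lee_fin powR_ge0.
have NG : ('N[pi]_p%:E[EFin \o G] = (quant_error nrm p nu x)%:E)%E.
  rewrite Lnorm_fin//; last by move=> z; exact: dm0.
  rewrite (@integral_coupling_snd pi (fun y => (dist_min nrm x y `^ p)%:E))//.
  - rewrite EFin_Rintegral; last exact: dist_min_integrable.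
    by rewrite poweR_EFin quant_errorE.
  - exact/measurable_EFinP.
  - by move=> y; rewrite lee_fin powR_ge0.
have ND : ('N[pi]_p%:E[EFin \o D] <= e%:E)%E.
  rewrite Lnorm_fin// -[e in X in (_ <= X)%E](powRK p0 e0) -poweR_EFin.
  apply: gt0_ler_poweR => //.
  - by rewrite invr_ge0 ltW.
  - rewrite in_itv/= leey andbT.
    by apply: integral_ge0 => z _; rewrite lee_fin powR_ge0.
  - by rewrite in_itv/= leey andbT lee_fin powR_ge0.
have mono (A B : borelRd R d * borelRd R d -> R) : measurable_fun setT A ->
    measurable_fun setT B -> (forall z, 0 <= A z) -> (forall z, 0 <= B z) ->
    (forall z, A z <= B z + D z) ->
    ('N[pi]_p%:E[EFin \o A] <= 'N[pi]_p%:E[EFin \o B] + e%:E)%E.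
  move=> mA mB A0 B0 AB.
  apply: (@le_trans _ _ ('N[pi]_p%:E[EFin \o (B \+ D)%R])%E); last first.
    apply: (le_trans (minkowski_EFin pi mB mD hp)); exact: leeD2l.
  have BD0 z : 0 <= (B \+ D) z by exact: addr_ge0.
  have mpow (H : borelRd R d * borelRd R d -> R) : measurable_fun setT H ->
      measurable_fun setT (fun z => (H z `^ p)%:E).
    by move=> mH; apply/measurable_EFinP; exact: (measurableT_comp (measurable_powR p) mH).
  rewrite !Lnorm_fin//; apply: gt0_ler_poweR.
  - by rewrite invr_ge0 ltW.
  - rewrite in_itv/= leey andbT.
    by apply: integral_ge0 => z _; rewrite lee_fin powR_ge0.
  - rewrite in_itv/= leey andbT.
    by apply: integral_ge0 => z _; rewrite lee_fin powR_ge0.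
  - apply: ge0_le_integral => //.
    + by move=> z _; rewrite lee_fin powR_ge0.
    + exact: mpow.
    + by apply: mpow; exact: measurable_funD.
    + by move=> z _; rewrite lee_fin; apply: le_powR; rewrite ?(ltW p0)//; exact: AB.
have h1 := mono F G mF mG (fun z => dm0 _) (fun z => dm0 _)
  (fun z => dist_min_lipschitz hn x z.1 z.2).
have GF z : G z <= F z + D z.
  by rewrite /D (nrmB hn); exact: dist_min_lipschitz.
have h2 := mono G F mG mF (fun z => dm0 _) (fun z => dm0 _) GF.
move: h1 h2; rewrite NF NG -!EFinD !lee_fin ler_norml => h1 h2.
by apply/andP; split; lra.
Qed.

Lemma quant_error_wasserstein n (x : {ffun 'I_n.+1 -> 'rV[R]_d}) (e : R) :
  finite_moment nrm p mu -> finite_moment nrm p nu -> 0 < e ->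
  (wasserstein nrm p mu nu < e%:E)%E ->
  `|quant_error nrm p mu x - quant_error nrm p nu x| <= e.
Proof.
move=> fmu fnu e0 We.
have : (ereal_inf [set (\int[pi]_(z in setT)
    ((nrm ((z.1 : 'rV[R]_d) - z.2)) `^ p)%:E)%E | pi in coupling mu nu] < (e `^ p)%:E)%E.
  rewrite ltNge; apply/negP => le; move: We; rewrite ltNge => /negP; apply.
  rewrite -[e](powRK p0 (ltW e0)) -poweR_EFin /wasserstein.
  apply: gt0_ler_poweR => //.
  - by rewrite invr_ge0 ltW.
  - by rewrite in_itv/= leey andbT lee_fin powR_ge0.
  - by rewrite in_itv/= leey andbT (le_trans _ le)// lee_fin powR_ge0.
move=> /ereal_inf_lt[_ [pi cpl <-]] /ltW cost.
exact: quant_error_coupling fmu fnu cpl (ltW e0) cost.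
Qed.

End quantizer_lipschitz.

(** * Uniform convergence and the cycle of implications *)

Section uniform_real.
Context {R : realType} {U : choiceType}.

Lemma cvg_uniform_realP (f : nat -> U -> R) (g : U -> R) :
  {uniform, f @ \oo --> g} <->
  (forall e, 0 < e -> \forall n \near \oo, forall x, `|g x - f n x| < e).
Proof.
split=> [fg e e0|fg P /uniform_nbhs[E [+ EP]]].
  apply: (fg [set h | forall x, `|g x - h x| < e]).
  apply/uniform_nbhs; exists [set xy : R * R | ball xy.1 e xy.2]; split.
    exact: entourage_ball (PosNum e0).
  by move=> h hE x; exact: hE.
rewrite -entourage_ballE => -[e /= e0 eE].
have := fg e e0; apply: filterS => n gfn; apply: EP => x _.
exact/eE/gfn.
Qed.

End uniform_real.

Theorem theorem2p2 (R : realType) (d : nat) (hd : (1 <= d)%N)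
    (p : R) (hp : 1 <= p)
    (nrm : 'rV[R]_d -> R) (hnrm : is_norm nrm)
    (mu : nat -> probability (borelRd R d) R)
    (mu_oo : probability (borelRd R d) R)
    (hmu : forall n : nat, (1 <= n)%N -> finite_moment nrm p (mu n))
    (hmu_oo : finite_moment nrm p mu_oo) :
  [<-> (fun n : nat => wasserstein nrm p (mu n) mu_oo) @ \oo --> 0%E;
       forall N : nat, (1 <= N)%N ->
         {uniform, (fun n : nat => quant_error nrm p (N := N) (mu n)) @ \oo -->
                   quant_error nrm p (N := N) mu_oo};
       exists N : nat,
         ((sphere_covering_number nrm + 1 <= N)%N \/
          (euclidean_norm nrm /\ (d + 2 <= N)%N)) /\
         forall x : {ffun 'I_N -> 'rV[R]_d},
           (fun n : nat => quant_error nrm p (mu n) x) @ \oo -->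
           quant_error nrm p mu_oo x].
Proof.
have p0 : 0 < p by exact: lt_le_trans hp.
tfae.
- move=> W0 [//|N] _; apply/cvg_uniform_realP => e e0.
  have e2 : 0 < e / 2 by rewrite divr_gt0.
  have : \forall n \near \oo, (wasserstein nrm p (mu n) mu_oo < (e / 2)%:E)%E.
    by apply: (W0 [set z | (z < (e / 2)%:E)%E]); exact: lt_nbhsl.
  move=> Wn; near=> n => x; rewrite distrC.
  (* Halving [e] recovers the strict inequality of uniform convergence from the large one of the
     Lipschitz bound. *)
  apply: (@le_lt_trans _ _ (e / 2)); last by rewrite ltr_pdivrMr// ltr_pMr// ltr1n.
  apply: quant_error_wasserstein => //.
  + by apply: hmu; near: n; exists 1.
  + by near: n.
- move=> H; exists (sphere_covering_number nrm + 1)%N; split; first by left.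
  move=> x; have := H (sphere_covering_number nrm + 1)%N; rewrite {1}addn1.
  move=> /(_ isT)/cvg_uniform_realP U; apply/cvgrPdist_lt => e e0.
  by have := U e e0; apply: filterS => n /(_ x).
- move=> [N [hN cvgN]].
  (* [N = m.+2] leaves [m.+1] slots for absorbing vectors and one for the centre; when [N] exceeds
     the threshold, the surplus slots repeat a vector. *)
  have [m [b [r0 [NE babs]]]] : exists m (b : 'I_m.+1 -> 'rV[R]_d) r0,
      N = m.+2 /\ absorbing nrm b r0.
    have [n [b [r0 [nN babs]]]] : exists n (b : 'I_n.+1 -> 'rV[R]_d) r0,
        (n.+2 <= N)%N /\ absorbing nrm b r0.
      case: hN => [|[eucl]]; last first.
        rewrite addn2 => dN; have [b [r0 babs]] := euclidean_absorbing hnrm hd eucl.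
        by exists d, b, r0.
      have [a [a1 cov]] := sphere_covering_numberP hnrm.
      move: a a1 cov; case: (sphere_covering_number nrm) => [|k] a a1 cov cN.
        (* Covering number 0 would mean an empty sphere, which [hd] excludes. *)
        pose v : 'rV[R]_d := delta_mx ord0 (Ordinal hd).
        have v0 : v != 0.
          apply/eqP => /rowP/(_ (Ordinal hd)); rewrite !mxE !eqxx => /eqP.
          by rewrite oner_eq0.
        have : unit_sphere nrm ((nrm v)^-1 *: v).
          rewrite /unit_sphere/= (is_normZ hnrm) ger0_norm ?invr_ge0 ?nrm_ge0//.
          by rewrite mulVf// gt_eqF// nrm_gt0.
        by move=> /cov[[]].
      exists k, a, 1; split; first by rewrite addn1 in cN.
      exact: covering_absorbing.
    case: N hN cvgN nN => [//|[//|m]] _ _ nm.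
    have [b' b'abs] := absorbing_pad (nm : (n <= m)%N) babs.
    by exists m, b', r0.
  subst N.
  have cvgI (x : {ffun 'I_m.+2 -> 'rV[R]_d}) := cvg_quant_error_Rintegral hnrm hp hmu hmu_oo (cvgN x).
  apply: cvg_wasserstein => //.
    move=> f cf bf.
    apply: (cvg_bounded_support (@quantizer_bump_continuous R d nrm hnrm p hp m b)
      (quantizer_bump_ge0 p b) (quantizer_bump_gt0 hnrm hp babs)
      (quantizer_bump_bounded_support hnrm hp babs) _ cf bf).
    + move=> a r r_gt0.
      have bE (nu : probability (borelRd R d) R) : finite_moment nrm p nu ->
          \int[nu]_x (quantizer_bump nrm p b (r^-1 *: (x - a))) =
          (r `^ p)^-1 * (\int[nu]_x (dist_min nrm (outer_quantizer b a r) x `^ p)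
            - \int[nu]_x (dist_min nrm (full_quantizer b a r) x `^ p)).
        move=> fnu; under eq_Rintegral do rewrite (quantizer_bump_scale hnrm hp)//.
        rewrite RintegralZl//.
          by rewrite RintegralB//; exact: dist_min_integrable.
        by apply: integrable_EFinB; exact: dist_min_integrable.
      rewrite bE//.
      have : (fun n => (r `^ p)^-1 *
          (\int[mu n]_x (dist_min nrm (outer_quantizer b a r) x `^ p)
            - \int[mu n]_x (dist_min nrm (full_quantizer b a r) x `^ p))) @ \oo -->
          (r `^ p)^-1 * (\int[mu_oo]_x (dist_min nrm (outer_quantizer b a r) x `^ p)
            - \int[mu_oo]_x (dist_min nrm (full_quantizer b a r) x `^ p)).
        by apply: cvgMl_tmp; apply: cvgB; exact: cvgI.
      apply: cvg_trans; apply: near_eq_cvg; exists 1 => //= n n1.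
      by rewrite bE//; exact: hmu.
  pose z : {ffun 'I_m.+2 -> 'rV[R]_d} := [ffun _ => 0].
  have zE (nu : probability (borelRd R d) R) :
      \int[nu]_xi (dist_min nrm z xi `^ p) = \int[nu]_xi (nrm xi `^ p).
    apply: eq_Rintegral => xi _; have [i ->] := dist_min_attained (nrm := nrm) z xi.
    by rewrite ffunE subr0.
  by have := cvgI z; rewrite zE; under eq_fun do rewrite zE.
Unshelve. all: by end_near. Qed.
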